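(* Let $b\ge 2$ be an integer and let $X$ be a real random variable with non-lattice distribution. Put $\phi(t):=E[e^{tX}]$ and suppose that $\phi$ reaches its infimum at a point $\rho>0$ lying in the interior of $\{t\in\mathbb{R}:\phi(t)<\infty\}$, and that $E[e^{\rho X}]=1/b$. Let $M$ be the maximal position reached by the $b$-ary branching random walk with step distribution $X$ killed below zero, and let $P^x$ be its law when the ancestor starts at $x\ge 0$. Then there exist constants $0<D_1\le D_2<\infty$ such that for every $x\ge 0$ there is $k_0=k_0(x)$ such that for all real $k\ge k_0$, $$D_1(1+x)\frac{e^{\rho(x-k)}}{k}\le P^x(M\ge k)\le D_2(1+x)\frac{e^{\rho(x-k)}}{k}.$$
   Context: Let $\mathcal{T}$ be the infinite rooted $b$-ary tree (every vertex has exactly $b$ children). Attach to every vertex $u$ other than the root a random variable $X_u$, the $X_u$ being i.i.d. with the law of $X$. For vertices, $v\le u$ means that $v$ is an ancestor of $u$ or $v=u$. Under $P^x$, the position of $u$ is $S(u):=x+\sum_{v\le u,\,v\ne \mathrm{root}}X_v$; in particular the root is at $x$. The maximum of the killed branching random walk is $$M:=\sup\{S(u): u\in\mathcal{T}\text{ such that } S(v)\ge 0\ \text{ for all } v\le u\}.$$ *)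

(* Defs.v *)
From mathcomp Require Export all_boot all_order all_algebra.
From mathcomp Require Export all_classical all_reals all_analysis.
Export numFieldNormedType.Exports.

Set Implicit Arguments.
Unset Strict Implicit.
Unset Printing Implicit Defensive.

Import Order.TTheory GRing.Theory Num.Theory.

Local Open Scope classical_set_scope.
Local Open Scope ring_scope.

(* A vertex of the infinite rooted b-ary tree is the word of child labels read
   along the path from the root: the root is [::], the children of u are the
   words rcons u i, and v <= u holds iff v is a prefix of u. *)
Notation vertex b := (seq 'I_b).

Definition tree_root (b : nat) : vertex b := [::].

Definition ancestor_or_self (b : nat) (v u : vertex b) : bool := prefix v u.

Definition lattice_distribution (R : realType)
    (mu : probability R R) : Prop :=
  exists a h : R, 0 < h /\ mu [set a + h * n%:~R | n in [set: int]] = 1%E.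

(* Mutual independence of the random variables X i, i ranging over A: the
   product rule over every finite subfamily with distinct indices in A. *)
Definition mutually_independent (d : measure_display) (T : measurableType d)
    (R : realType) (P : probability T R) (I : eqType) (A : set I)
    (X : I -> {RV P >-> R}) : Prop :=
  forall (s : seq I) (B : I -> set R),
    uniq s -> (forall i, i \in s -> A i) ->
    (forall i, i \in s -> measurable (B i)) ->
    P [set w | forall i, i \in s -> B i (X i w)] =
    (\prod_(i <- s) P (X i @^-1` B i))%E.

Definition iid_with_law (d : measure_display) (T : measurableType d)
    (R : realType) (P : probability T R) (I : eqType) (A : set I)
    (X : I -> {RV P >-> R}) (mu : probability R R) : Prop :=
  mutually_independent A X /\
  forall i, A i -> forall B : set R, measurable B -> distribution P (X i) B = mu B.

Section branching_random_walk.
Context (R : realType) (b : nat) (T : Type).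
Variables (X : vertex b -> T -> R) (x : R) (w : T).

(* For 1 <= i <= size u, take i u runs through the v <= u other than the root;
   the displacement X (tree_root b) is never used. *)
Definition position (u : vertex b) : R :=
  x + \sum_(1 <= i < (size u).+1) X (take i u) w.

Definition alive (u : vertex b) : Prop :=
  forall v : vertex b, ancestor_or_self v u -> 0 <= position v.

Definition killed_max : \bar R := ereal_sup [set (position u)%:E | u in alive].

End branching_random_walk.

(* Main.v *)
From HB Require Import structures.
Require Import Defs.
From mathcomp Require Import measurable_realfun ring lra.

Set Implicit Arguments.
Unset Strict Implicit.
Unset Printing Implicit Defensive.

Import Order.TTheory GRing.Theory Num.Theory.

Local Open Scope classical_set_scope.
Local Open Scope ring_scope.

(* Tilting the step law by [b * expR (rho * z)] turns it into a probability with
   mean zero (minimality of [rho]) and some exponential moments, and turns the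
   first moment of the branching walk into [expR (rho * (x - k))] times the
   probability that a centered walk started at [x] exceeds [k] before going below
   [0], which is of order [(1 + x) / k].  Rather than estimating the overshoots of
   that walk, one compares the hitting probability [u y] of the level [k] with
   explicit functions.  It satisfies [u y = 1 - (1 - E (u (y + X))) ^ b] for
   [0 <= y < k].  The linear function corrected by a small exponential near [0],
   [y + A - expR (- delta * y)], is superharmonic for the killed tilted walk, and
   gives the upper bound.  For the lower bound, the linear function is corrected
   near [k], [y + k * expR (delta * (y - k)) - k * expR (- delta * k)]: the drift
   thus gained pays for the truncation above [k + m] and for the quadratic loss in
   [1 - (1 - q) ^ b >= b * q - (b * q) ^ 2]. *)

(** * Events generated by disjoint families of independent variables *)

Section cylinders.
Context (R : realType) (T : pointedType) (I : eqType).
Implicit Types (X : I -> T -> R) (A : set I) (s : seq I) (B : I -> set R).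

Definition cylinder X s B : set T := [set w | forall i, i \in s -> B i (X i w)].

(** A generating pi-system for the sigma-algebra of the variables indexed by [A], which appears
    below as [<<s cylinders X A >>]. *)
Definition cylinders X A : set (set T) :=
  [set E | exists s B, [/\ uniq s, forall i, i \in s -> A i,
     forall i, measurable (B i) & E = cylinder X s B]].

Lemma cylinders_setI X A : setI_closed (cylinders X A).
Proof.
move=> _ _ [s [B [us sA mB ->]]] [t [C [ut tA mC ->]]].
exists (undup (s ++ t)), (fun i => (if i \in s then B i else setT) `&`
                            (if i \in t then C i else setT)); split.
- exact: undup_uniq.
- by move=> i; rewrite mem_undup mem_cat => /orP[/sA|/tA].
- by move=> i; apply: measurableI; case: ifP.
- apply/seteqP; split=> w /=.
    by move=> [Bw Cw] i _; split; case: ifP => // h; [exact: Bw|exact: Cw].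
  move=> H; split=> i iin; have := H i; rewrite mem_undup mem_cat iin ?orbT/=.
    by move=> /(_ isT)[].
  by move=> /(_ isT)[].
Qed.

Lemma cylinders_setT X A : cylinders X A setT.
Proof.
by exists [::], (fun=> setT); split => //; apply/seteqP; split => w.
Qed.

Lemma cylinders_sub X A A' : A `<=` A' -> cylinders X A `<=` cylinders X A'.
Proof. by move=> AA' _ [s [B [us sA mB ->]]]; exists s, B; split=> // i /sA/AA'. Qed.

Lemma cylinders1 X (i : I) (B : set R) : measurable B -> cylinders X [set i] (X i @^-1` B).
Proof.
move=> mB; exists [:: i], (fun=> B); split => //.
  by move=> j; rewrite inE => /eqP ->.
apply/seteqP; split => w /=; last by apply; rewrite mem_head.
by move=> Bw j; rewrite inE => /eqP ->.
Qed.

Lemma measurable_coordinate X A i : A i ->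
  measurable_fun setT (X i : g_sigma_algebraType (cylinders X A) -> R).
Proof.
move=> Ai _ B mB; rewrite setTI; apply: sub_sigma_algebra.
by apply: (cylinders_sub _ (cylinders1 X i mB)) => // _ ->.
Qed.

End cylinders.

Section independence.
Context (d : measure_display) (T : measurableType d) (R : realType)
  (P : probability T R) (I : eqType).
Implicit Types (A C : set I) (X : I -> {RV P >-> R}).

Lemma cylinders_measurable X A :
  cylinders X A `<=` (measurable : set (set T)).
Proof.
move=> _ [s [B [us sA mB ->]]].
rewrite (_ : cylinder _ _ _ = \big[setI/setT]_(i <- s) (X i @^-1` B i)).
  apply: bigsetI_measurable => i _.
  exact: measurable_funPTI.
elim: s {us sA} => [|i s IH]; first by rewrite big_nil; apply/seteqP; split.
rewrite big_cons -IH; apply/seteqP; split=> w /=.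
  by move=> H; split=> [|j js]; apply: H; rewrite inE ?eqxx ?js ?orbT.
by move=> [Hi Hs] j; rewrite inE => /orP[/eqP ->//|]; exact: Hs.
Qed.

Lemma sigma_cylinders_measurable X A :
  <<s cylinders X A >> `<=` (measurable : set (set T)).
Proof.
apply: smallest_sub; last exact: cylinders_measurable.
exact: sigma_algebra_measurable.
Qed.

(** Disjointness of [A] and [C] makes the concatenated index list duplicate-free, so that the
    product rule over it splits into the two factors; [G] merges the two families of sides. *)
Lemma cylinders_independent (D : set I) X A C E F :
    mutually_independent D X -> A `<=` D -> C `<=` D -> A `&` C = set0 ->
    cylinders X A E -> cylinders X C F ->
  P (E `&` F) = (P E * P F)%E.
Proof.
move=> indX AD CD AC0 [s [B [us sA mB ->]]] [t [B' [ut tC mB' ->]]].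
have st i : i \in t -> (i \in s) = false.
  move=> it; apply/negP => /sA Ai; have := tC _ it => Ci.
  by have : (A `&` C) i by []; rewrite AC0.
pose G i := if i \in s then B i else B' i.
have Es : cylinder X s B = [set w | forall i, i \in s -> G i (X i w)].
  apply/seteqP; split => w /= H i /[dup] iin /H; by rewrite /G iin.
have Et : cylinder X t B' = [set w | forall i, i \in t -> G i (X i w)].
  apply/seteqP; split => w /= H i /[dup] iin /H; by rewrite /G st.
have mG i : measurable (G i) by rewrite /G; case: ifP.
rewrite Es Et.
rewrite (indX s G us) ?(indX t G ut)//; last 2 first.
- by move=> i /tC/CD.
- by move=> i /sA/AD.
rewrite -big_cat/= -(indX (s ++ t) G)//.
- congr (P _); apply/seteqP; split=> w /=.
    by move=> [H1 H2] i; rewrite mem_cat => /orP[/H1|/H2].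
  by move=> H; split=> i iin; apply: H; rewrite mem_cat iin ?orbT.
- rewrite cat_uniq us ut andbT; apply/hasPn => i it /=.
  by rewrite st.
- by move=> i; rewrite mem_cat => /orP[/sA/AD|/tC/CD].
Qed.

(** The pi-lambda argument is used twice: [key] extends the product rule from a pi-system to the
    sigma-algebra it generates while the other event stays fixed, first for [F], then for [E]. *)
Lemma sigma_cylinders_independent (D : set I) X A C E F :
    mutually_independent D X -> A `<=` D -> C `<=` D -> A `&` C = set0 ->
    <<s cylinders X A >> E -> <<s cylinders X C >> F ->
  P (E `&` F) = (P E * P F)%E.
Proof.
move=> indX AD CD AC0 sE sF.
have mE := sigma_cylinders_measurable sE.
have mF := sigma_cylinders_measurable sF.
have fin (A0 : set T) : measurable A0 -> P A0 \is a fin_num by move=> ?; exact: fin_num_measure.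
have key (G : set (set T)) (H : set T) : measurable H ->
    setI_closed G -> G setT -> G `<=` measurable ->
    (forall E', G E' -> P (E' `&` H) = (P H * P E')%E) ->
    forall E', <<s G >> E' -> P (E' `&` H) = (P H * P E')%E.
  move=> mH GI GT Gm GP E' sE'.
  (* Two finite measures in [E'] are compared: [P] restricted to [H], and [P] scaled by the number
     [P H]. They agree on the pi-system [G]. *)
  pose r := NngNum (fine_ge0 (measure_ge0 P H)).
  have scaleE V : mscale r P V = (P H * P V)%E.
    by rewrite /mscale/= fineK// fin.
  rewrite -scaleE -[LHS]/(mrestr P mH E').
  apply: (@g_sigma_algebra_measure_unique d R T G Gm (fun=> setT) (fun=> GT) _
    (mrestr P mH) (mscale r P) GI) => //.
  - by rewrite bigcup_const//; exists 0%N.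
  - by move=> V GV; apply: (etrans (GP V GV)); rewrite -scaleE.
  - move=> _; apply: le_lt_trans (ltry 1).
    exact: (probability_le1 P (measurableI _ _ measurableT mH)).
have step1 E' : cylinders X A E' -> P (E' `&` F) = (P E' * P F)%E.
  move=> cE'; rewrite setIC; apply: (key (cylinders X C)) => //.
  - by apply: cylinders_measurable cE'.
  - exact: cylinders_setI.
  - exact: cylinders_setT.
  - exact: cylinders_measurable.
  - move=> F' cF'; rewrite setIC.
    exact: (cylinders_independent indX AD CD AC0).
rewrite muleC; apply: (key (cylinders X A)) => //.
- exact: cylinders_setI.
- exact: cylinders_setT.
- exact: cylinders_measurable.
- by move=> E' cE'; rewrite step1// muleC.
Qed.

End independence.

(** * Reaching a level before being killed *)

Section reach.
Context (R : realType) (b : nat).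
Implicit Types (xi : vertex b -> R) (n : nat) (k x y : R).

(* The walk started at [y] attains [k] within [n] generations along a line that
   stays nonnegative; as in [position], the root displacement is never used. *)
Fixpoint reach n xi k y : Prop :=
  0 <= y /\ (k <= y \/
    if n is n'.+1 then exists i, reach n' (fun u => xi (i :: u)) k (y + xi [:: i])
    else False).

Lemma reachSn n xi k y : reach n xi k y -> reach n.+1 xi k y.
Proof.
elim: n xi y => [|n IH] xi y; first by move=> [y0 [ky|//]]; split => //; left.
move=> [y0 [ky|[i H]]]; split => //; first by left.
by right; exists i; apply: IH; exact: H.
Qed.

Lemma reach_leq m n xi k y : (m <= n)%N -> reach m xi k y -> reach n xi k y.
Proof.
move=> /subnK <-; elim: (n - m)%N => [//|j IH] /IH.
by rewrite addSn; exact: reachSn.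
Qed.

Lemma reach_le_start n xi k y y' :
  y <= y' -> reach n xi k y -> reach n xi k y'.
Proof.
elim: n xi y y' => [|n IH] xi y y' yy' /= [y0 H]; split; rewrite ?(le_trans y0)//.
  by case: H => [H|//]; left; exact: le_trans yy'.
case: H => [H|[i H]]; first by left; exact: le_trans yy'.
by right; exists i; apply: IH H; rewrite lerD2r.
Qed.

Lemma reach_threshold n xi k k' y :
  k' <= k -> reach n xi k y -> reach n xi k' y.
Proof.
move=> kk'; elim: n xi y => [|n IH] xi y /= [y0 H]; split => //.
  by case: H => [H|//]; left; exact: le_trans H.
case: H => [H|[i H]]; first by left; exact: le_trans H.
by right; exists i; exact: IH.
Qed.

Lemma position_cons (T : Type) (X : vertex b -> T -> R) x w i u :
  position X x w (i :: u) =
  position (fun v => X (i :: v)) (x + X [:: i] w) w u.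
Proof.
by rewrite /position /= big_nat_recl//= take0 addrA.
Qed.

Lemma position_nil (T : Type) (X : vertex b -> T -> R) x w :
  position X x w [::] = x.
Proof. by rewrite /position big_nil addr0. Qed.

Lemma alive_cons (T : Type) (X : vertex b -> T -> R) x w i u :
  alive X x w (i :: u) <->
  0 <= x /\ alive (fun v => X (i :: v)) (x + X [:: i] w) w u.
Proof.
split=> [H|[x0 H] [|j v]].
- split; first by rewrite -(position_nil X x w); exact: H.
  by move=> v vu; rewrite -position_cons; apply: H; rewrite /ancestor_or_self /= eqxx.
- by rewrite position_nil.
- rewrite /ancestor_or_self /= => /andP[/eqP -> vu].
  by rewrite position_cons; exact: H.
Qed.

Lemma alive_nil (T : Type) (X : vertex b -> T -> R) x w :
  alive X x w [::] <-> 0 <= x.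
Proof.
split=> [/(_ [::] isT)|x0 [|//] _]; by rewrite position_nil.
Qed.

(** The bridge between the recursion [reach] and the vertices over which [killed_max] is taken. *)
Lemma reachP (T : Type) (X : vertex b -> T -> R) k x w :
  (exists n, reach n (X^~ w) k x) <->
  exists u, alive X x w u /\ k <= position X x w u.
Proof.
split=> [[n]|[u]].
- elim: n X x => [|n IH] X x /=.
    by move=> [x0 [kx|//]]; exists [::]; rewrite position_nil alive_nil.
  move=> [x0 [kx|[i /(IH (fun v => X (i :: v)))[u [au ku]]]]].
    by exists [::]; rewrite position_nil alive_nil.
  by exists (i :: u); rewrite alive_cons position_cons.
- elim: u X x => [|i u IH] X x.
    by rewrite position_nil alive_nil => -[x0 kx]; exists 0%N => /=; split => //; left.
  rewrite alive_cons position_cons => -[[x0 au] ku].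
  have [n rn] := IH (fun v => X (i :: v)) _ (conj au ku).
  by exists n.+1; split => //; right; exists i.
Qed.

(** The supremum need not be attained, so only levels strictly below [k] are sure to be reached; a
    sequence of levels increasing to [k] suffices. *)
Lemma killed_max_geP (T : Type) (X : vertex b -> T -> R) k x w :
  (k%:E <= killed_max X x w)%E <->
  forall m : nat, exists n, reach n (X^~ w) (k - m.+1%:R^-1) x.
Proof.
split.
- move=> kM m; apply/reachP.
  have : ((k - m.+1%:R^-1)%:E < killed_max X x w)%E.
    apply: lt_le_trans kM; rewrite lte_fin ltrBlDr ltrDl.
    by rewrite invr_gt0 ltr0n.
  move=> /ereal_sup_gt[_ [u au <-]]; rewrite lte_fin => ku.
  by exists u; split => //; exact: ltW.
- move=> H; apply/lee_addgt0Pr => e e0.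
  have [m me] : exists m : nat, m.+1%:R^-1 < e.
    exists (Num.truncn e^-1).
    rewrite invf_plt ?posrE ?ltr0n//.
    exact: truncnS_gt.
  have /reachP[u [au ku]] := H m.
  apply: (@le_trans _ _ ((position X x w u)%:E + e%:E)%E).
    rewrite -EFinD lee_fin -lerBlDr; apply: le_trans ku.
    by rewrite lerD2l lerN2 ltW.
  by rewrite leeD2r//; apply: ereal_sup_ubound; exists u.
Qed.

(** The starting point is a random [g w] because in the induction child [i] starts at [g w + X
    [:: i] w]. The space [T] is arbitrary so as to cover sub-sigma-algebras and product spaces
    later. *)
Lemma measurable_reach (d : measure_display) (T : measurableType d)
    (X : vertex b -> T -> R) (g : T -> R) n k :
    (forall u, u <> [::] -> measurable_fun setT (X u)) ->
    measurable_fun setT g ->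
  measurable [set w | reach n (X^~ w) k (g w)].
Proof.
elim: n X g => [|n IH] X g mX mg.
- rewrite (_ : mkset _ = g @^-1` `[0, +oo[ `&` g @^-1` `[k, +oo[).
    by apply: measurableI; rewrite -[X in measurable X]setTI; exact: mg.
  apply/seteqP; split => w /=; rewrite !in_itv/= !andbT.
    by move=> [? []].
  by move=> [? ?]; split => //; left.
- rewrite (_ : mkset _ = g @^-1` `[0, +oo[ `&` (g @^-1` `[k, +oo[ `|`
    \bigcup_(i in [set: 'I_b])
       [set w | reach n (fun u => X (i :: u) w) k (g w + X [:: i] w)])).
    apply: measurableI; first by rewrite -[X in measurable X]setTI; exact: mg.
    apply: measurableU; first by rewrite -[X in measurable X]setTI; exact: mg.
    apply: fin_bigcup_measurable => [|i _]; first exact: finite_finset.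
    apply: (IH (fun u => X (i :: u))).
      by move=> u _; exact: mX.
    by apply: measurable_funD => //; exact: mX.
  apply/seteqP; split => w /=; rewrite !in_itv/= !andbT.
    by move=> [? [?|[i ?]]]; split => //; [left|right; exists i].
  by move=> [? [?|[i _ ?]]]; split => //; [left|right; exists i].
Qed.

End reach.

(** * The first generation: events of a branch and integration over the first step *)

Section one_step.
Context (R : realType) (b : nat) (d : measure_display) (T : measurableType d)
  (P : probability T R).
Variables (mu : probability R R) (X : vertex b -> {RV P >-> R}).
Hypothesis X_iid : iid_with_law [set u | u <> tree_root b] X mu.

Definition subtree (i : 'I_b) (u : vertex b) : {RV P >-> R} := X (i :: u).

Lemma subtree_iid i :
  iid_with_law [set u | u <> tree_root b] (subtree i) mu.
Proof.
case: X_iid => indX lawX; split => [s B us sA mB|u _]; last exact: lawX.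
have := indX (map (cons i) s) (fun u => B (behead u)).
rewrite big_map => <-.
- congr (P _); apply/seteqP; split=> w /= H u.
    by move=> /mapP[v vs ->]; exact: H.
  by move=> us'; apply: (H (i :: u)); exact: map_f.
- by rewrite map_inj_uniq// => u v [].
- by move=> _ /mapP[v _ ->].
- by move=> _ /mapP[v vs ->] /=; exact: mB.
Qed.

Definition child_reach n k y i : set T :=
  [set w | reach n (fun u => subtree i u w) k (y + X [:: i] w)].

Definition branch (i : 'I_b) : set (vertex b) := [set u | exists v, u = i :: v].

(** Running [measurable_reach] on [T] equipped with the sigma-algebra of branch [i] shows that the
    event depends on this branch only. *)
Lemma child_reach_sigma n k y i :
  <<s cylinders X (branch i) >> (child_reach n k y i).
Proof.
have mX (u : vertex b) : measurable_fun setT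
    (X (i :: u) : g_sigma_algebraType (cylinders X (branch i)) -> R).
  by apply: measurable_coordinate; exists u.
apply: (@measurable_reach R b _ (g_sigma_algebraType (cylinders X (branch i)))
   (fun u => X (i :: u)) (fun w => y + X [:: i] w)) => [u _|].
  exact: mX.
by apply: measurable_funD => //; exact: measurable_cst.
Qed.

Lemma child_reach_measurable n k y i : measurable (child_reach n k y i).
Proof.
apply: (@sigma_cylinders_measurable _ T R P _ X (branch i)).
exact: child_reach_sigma.
Qed.

Lemma reach_measurable n k y : measurable [set w | reach n (X^~ w) k y].
Proof.
by apply: measurable_reach => [u _|]; [exact: measurable_funPT|exact: measurable_cst].
Qed.


(** The step [X [:: i]] is independent of the displacements strictly below child [i]; their joint
    law is a product measure, whose value on an event is the integral of the measures of its
    sections. *)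
Lemma child_reach_integral n k y i :
  P (child_reach n k y i) =
  (\int[mu]_z P [set w | reach n (fun u => subtree i u w) k (y + z)])%E.
Proof.
case: X_iid => indX lawX.
pose A := [set u : vertex b | exists v, v <> [::] /\ u = i :: v].
(* [T'] is [T] with only the events of the variables strictly below child [i], so that the law of
   [prm] on [R * T'] is a product. *)
pose T' := g_sigma_algebraType (cylinders X A).
have AD : A `<=` [set u | u <> tree_root b] by move=> _ [v [_ ->]].
have sM := @sigma_cylinders_measurable _ T R P _ X A.
have mid : measurable_fun setT (id : T -> T').
  by move=> _ B mB; rewrite setTI preimage_id; exact: sM.
have mX1 : measurable_fun setT (X [:: i]) by exact: measurable_funPT.
have mpr : measurable_fun setT (fun w => (X [:: i] w, w) : R * T').
  exact: measurable_fun_pair.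
pose idm : {mfun T >-> T'} := HB.pack (id : T -> T') (isMeasurableFun.Build _ _ _ _ _ mid).
pose prm : {mfun T >-> (R * T')%type} :=
  HB.pack (fun w => (X [:: i] w, w) : R * T') (isMeasurableFun.Build _ _ _ _ _ mpr).
pose Phi := [set p : R * T' | reach n (fun u => X (i :: u) p.2) k (y + p.1)].
have mPhi : measurable Phi.
  apply: (@measurable_reach R b _ _ (fun u (p : R * T') => X (i :: u) p.2)
    (fun p => y + p.1)) => [u u0|].
    apply: (@measurableT_comp _ _ _ _ _ _ (X (i :: u) : T' -> R) setT snd) => //.
    by apply: measurable_coordinate; exists u.
  by apply: measurable_funD => //; exact: measurable_cst.
have := @product_measure_unique _ _ _ T' R mu (distribution P idm)
  (distribution P prm) _ Phi mPhi.
move=> /(_ _)/wrap[|E].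
  move=> B C mB mC.
  have h1 : mu B = P (X [:: i] @^-1` B) by rewrite -(lawX [:: i]).
  transitivity (P ((X [:: i] @^-1` B) `&` C)) => //.
  transitivity (P (X [:: i] @^-1` B) * P C)%E; last by congr (_ * _)%E; exact: esym h1.
  apply: (@sigma_cylinders_independent _ T R P _ [set u | u <> tree_root b]
    X [set [:: i]] A) => //.
  - by move=> u /= ->.
  - by apply/seteqP; split => // u [/= -> [v [v0 [vE]]]]; apply: v0.
  - by apply: sub_sigma_algebra; exact: cylinders1.
transitivity (distribution P prm Phi) => //; rewrite -E.
apply: eq_integral => z _ /=.
by rewrite /distribution /pushforward /= xsectionE.
Qed.

End one_step.

(** * Comparison with super- and subsolutions *)

Section comparison.
Context (R : realType) (b : nat) (d : measure_display) (T : measurableType d)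
  (P : probability T R) (mu : probability R R).
Implicit Types (X : vertex b -> {RV P >-> R}) (g h : R -> R).

Let iid X := iid_with_law [set u | u <> tree_root b] X mu.

(** A higher start makes [reach] easier, and a monotone function is measurable. *)
Lemma prob_reach_measurable X n k (D : set R) y : measurable D ->
  measurable_fun D (fun z => P [set w | reach n (X^~ w) k (y + z)]).
Proof.
move=> mD.
have mr z := reach_measurable X n k z.
rewrite (_ : (fun _ => _) =
    EFin \o (fun z => fine (P [set w | reach n (X^~ w) k (y + z)]))); last first.
  by apply/funext => z /=; rewrite fineK// fin_num_measure.
apply/measurable_EFinP; apply: nondecreasing_measurable => // z z' zz'.
apply: fine_le; rewrite ?fin_num_measure//.
apply: le_measure; rewrite ?inE//.
by move=> w; apply: reach_le_start; rewrite lerD2l.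
Qed.

Lemma prob_reach_eq0 X n k y : y < 0 -> P [set w | reach n (X^~ w) k y] = 0%E.
Proof.
move=> y0; rewrite (_ : mkset _ = set0) ?measure0//.
by apply/seteqP; split => // w; case: n => [|n] [] /=; rewrite leNgt y0.
Qed.

Lemma prob_reach_eq1 X n k y : 0 <= y -> k <= y ->
  P [set w | reach n (X^~ w) k y] = 1%E.
Proof.
move=> y0 ky; rewrite (_ : mkset _ = setT) ?probability_setT//.
by apply/seteqP; split => // w _; case: n => [|n]; split => //; left.
Qed.

Lemma child_reach_sub_reach X n k y i : 0 <= y ->
  child_reach X n k y i `<=` [set w | reach n.+1 (X^~ w) k y].
Proof. by move=> y0 w H; split => //; right; exists i. Qed.

Lemma reach_recE X n k y : 0 <= y -> y < k ->
  [set w | reach n.+1 (X^~ w) k y] =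
  \big[setU/set0]_(i < b) child_reach X n k y i.
Proof.
move=> y0 yk; rewrite -bigcup_seq; apply/seteqP; split => w /=.
  move=> [_ [|[i H]]]; first by rewrite leNgt yk.
  by exists i => //=; rewrite mem_index_enum.
by move=> [i _ H]; split => //; right; exists i.
Qed.

Lemma measure_bigsetU_le (J : Type) (s : seq J) (F : J -> set T) :
    (forall i, measurable (F i)) ->
  (P (\big[setU/set0]_(i <- s) F i) <= \sum_(i <- s) P (F i))%E.
Proof.
move=> mF; elim: s => [|i s IH]; first by rewrite !big_nil measure0.
rewrite !big_cons; apply: le_trans (leeD2l _ IH).
by apply: measureU2 => //; exact: bigsetU_measurable.
Qed.

(** Induction on the generation with a union bound over the [b] children: [0 <= h] covers the killed
    region, [1 <= h] the target, and the integral inequality the first step from in between. *)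
Lemma reach_le_supersolution h k : measurable_fun setT h ->
    (forall y, 0 <= h y) -> (forall y, k <= y -> 1 <= h y) ->
    (forall y, 0 <= y -> y < k ->
      (b%:R%:E * \int[mu]_z (h (y + z))%:E <= (h y)%:E)%E) ->
  forall n X y, iid X -> (P [set w | reach n (X^~ w) k y] <= (h y)%:E)%E.
Proof.
move=> mh h0 h1 hsup n; elim: n => [|n IH] X y iX.
all: have [y0|y0] := ltP y 0; first by rewrite prob_reach_eq0// lee_fin.
all: have [ky|yk] := leP k y; first by rewrite prob_reach_eq1// lee_fin h1.
  rewrite (_ : mkset _ = set0) ?measure0 ?lee_fin//.
  by apply/seteqP; split => // w [_ []//]; rewrite leNgt yk.
rewrite reach_recE//; apply: le_trans (hsup _ y0 yk).
apply: (@le_trans _ _ (\sum_(i < b) P (child_reach X n k y i))%E).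
  by apply: measure_bigsetU_le => i; exact: child_reach_measurable.
apply: (@le_trans _ _ (\sum_(i < b) \int[mu]_z (h (y + z))%:E)%E).
  apply: lee_sum => i _; rewrite (child_reach_integral iX).
  apply: ge0_le_integral => //.
  - exact: prob_reach_measurable.
  - apply/measurable_EFinP; apply: measurableT_comp mh _.
    exact: measurable_funD.
  - by move=> z _; apply: IH; exact: subtree_iid.
by rewrite sumr_const card_ord mule_natl.
Qed.

(** The list [s] of children is arbitrary so that they can be split off one at a time. *)
Definition no_child_reach X n k y (s : seq 'I_b) : set T :=
  [set w | forall i, i \in s -> ~ child_reach X n k y i w].

Lemma no_child_reach_cons X n k y i s :
  no_child_reach X n k y (i :: s) =
  ~` child_reach X n k y i `&` no_child_reach X n k y s.
Proof.
apply/seteqP; split => w /= H.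
  by split => [|j jt]; apply: H; rewrite inE ?eqxx ?jt ?orbT.
by move: H => [Hi Ht] j; rewrite inE => /orP[/eqP ->|/Ht].
Qed.

Lemma no_child_reach_nil X n k y : no_child_reach X n k y [::] = setT.
Proof. by apply/seteqP. Qed.

Lemma no_child_reach_sigma X n k y s :
  <<s cylinders X [set u : vertex b | exists2 i, i \in s & branch i u] >>
    (no_child_reach X n k y s).
Proof.
elim: s => [|i s IH].
  rewrite no_child_reach_nil.
  exact: (@measurableT _ (g_sigma_algebraType (cylinders X _))).
rewrite no_child_reach_cons.
apply: (@measurableI _ (g_sigma_algebraType (cylinders X _))).
  apply: (@measurableC _ (g_sigma_algebraType (cylinders X _))).
  apply: sub_sigma_algebra2 (@child_reach_sigma R b d T P X n k y i).
  by apply: cylinders_sub => u ui; exists i => //; rewrite mem_head.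
apply: sub_sigma_algebra2 IH; apply: cylinders_sub => u [j jt uj].
by exists j => //; rewrite inE jt orbT.
Qed.

Lemma no_child_reach_measurable X n k y s : measurable (no_child_reach X n k y s).
Proof.
by apply: (@sigma_cylinders_measurable _ T R P); exact: no_child_reach_sigma.
Qed.

(** Distinct children depend on disjoint branches, so their failures are independent, each of
    probability at most [1 - q]. *)
Lemma prob_no_child_le X n k y (q : R) (s : seq 'I_b) : iid X -> uniq s ->
    (forall i, (q%:E <= P (child_reach X n k y i))%E) -> 0 <= q <= 1 ->
  (P (no_child_reach X n k y s) <= ((1 - q) ^+ size s)%:E)%E.
Proof.
move=> iX us qP /andP[q0 q1]; case: (iX) => indX _.
elim: s us => [_|i s IH /= /andP[iNs us]].
  by rewrite expr0 no_child_reach_nil; exact: probability_le1.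
rewrite no_child_reach_cons.
have mc := child_reach_measurable X n k y i.
rewrite (@sigma_cylinders_independent _ T R P _ [set u | u <> tree_root b] X
  (branch i) _ _ _ _ _ _ _ _ (@no_child_reach_sigma X n k y s))//; last 4 first.
- by move=> _ [v ->].
- by move=> _ [j _ [v ->]].
- apply/seteqP; split => // u [[v ->] [j js [v' [ij _]]]].
  by move: iNs; rewrite ij js.
- apply: (@measurableC _ (g_sigma_algebraType (cylinders X (branch i)))).
  exact: child_reach_sigma.
rewrite exprS EFinM; apply: lee_pmul => //; last exact: IH.
by rewrite probability_setC// EFinB leeB.
Qed.

(** One step of the recursion for the hitting probability, as an inequality. The bound [g] is
    assumed for every iid family, hence holds for each subtree. *)
Lemma prob_reach_step_ge g k n y (q : R) X :
    measurable_fun setT g -> (forall z, 0 <= g z) ->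
    (forall X, iid X -> forall z, ((g z)%:E <= P [set w | reach n (X^~ w) k z])%E) ->
    iid X -> 0 <= y -> 0 <= q <= 1 ->
    (q%:E <= \int[mu]_z (g (y + z))%:E)%E ->
  ((1 - (1 - q) ^+ b)%:E <= P [set w | reach n.+1 (X^~ w) k y])%E.
Proof.
move=> mg g0 gP iX y0 q01 qint.
have mr := reach_measurable X n.+1 k y.
have qc i : (q%:E <= P (child_reach X n k y i))%E.
  apply: le_trans qint _; rewrite (child_reach_integral iX).
  apply: ge0_le_integral => //.
  - by move=> z _; rewrite lee_fin.
  - apply/measurable_EFinP; apply: measurableT_comp mg _.
    exact: measurable_funD.
  - exact: prob_reach_measurable.
  - by move=> z _; apply: gP; exact: subtree_iid.
rewrite -[mkset _]setCK probability_setC; last exact: measurableC.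
have mn := no_child_reach_measurable X n k y (enum 'I_b).
rewrite EFinB; apply: leeB => //.
apply: (@le_trans _ _ (P (no_child_reach X n k y (enum 'I_b)))).
  apply: le_measure; rewrite ?inE//; first exact: measurableC.
  move=> w nw i _ ci; apply: nw.
  exact: child_reach_sub_reach ci.
have := prob_no_child_le iX (enum_uniq 'I_b) qc q01.
by rewrite -cardE card_ord.
Qed.

End comparison.

(** * Exponentially tilted expectations *)

Section expR_bounds.
Context (R : realType).
Implicit Types u v : R.

Lemma expR_sub1_le v : expR v - 1 <= v * expR v.
Proof.
have h := expR_ge1Dx (- v); have e0 := expR_gt0 v.
have e : expR (- v) * expR v = 1 by rewrite -expRD addNr expR0.
by nra.
Qed.

Lemma expR_le_quadratic v : expR v <= 1 + v + v ^+ 2 * (1 + expR v).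
Proof.
have h := expR_sub1_le v; have e0 := expR_gt0 v; rewrite expr2.
have h' := expR_ge1Dx v; have v2 := sqr_ge0 v; rewrite expr2 in v2.
have v2e : 0 <= v * v * expR v by rewrite mulr_ge0// ltW.
have [v0|v0] := leP 0 v.
  have : v * (expR v - 1) <= v * (v * expR v) by rewrite ler_wpM2l.
  by nra.
have : v * expR v <= v * (1 + v) by rewrite ler_wnM2l// ltW.
by nra.
Qed.

Lemma norm_le_cosh u : `|u| <= expR u + expR (- u).
Proof.
have h1 := expR_ge1Dx u; have h2 := expR_ge1Dx (- u).
have := expR_gt0 u; have := expR_gt0 (- u).
by rewrite ler_norml => *; apply/andP; split; lra.
Qed.

Lemma sqr_le_cosh u : u ^+ 2 <= 2 * (expR u + expR (- u)).
Proof.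
wlog u0 : u / 0 <= u.
  move=> H; have [/H//|u0] := leP 0 u.
  by have := H (- u); rewrite sqrrN opprK addrC; apply; lra.
have := expR_ge1Dxn 1 u0; rewrite /= => h; have := expR_gt0 (- u).
by move: h; rewrite (_ : 2`! = 2)%N//; lra.
Qed.

(** A second-order expansion in [l] whose remainder is [l ^+ 2] times a function free of [l]; for
    [u] equal to plus or minus [delta * z] this function is integrable under the tilted law. *)
Lemma expR_dominate u (l : R) : 0 <= l <= 1 ->
  expR (l * u) <= 1 + l * u + l ^+ 2 * (8 * (expR (2 * u) + expR (- (2 * u)))).
Proof.
move=> /andP[l0 l1].
have h := expR_le_quadratic (l * u).
have sq := sqr_le_cosh u.
have e2 v : expR (2 * v) = expR v * expR v.
  by rewrite -expRD; congr expR; ring.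
have eN : expR u * expR (- u) = 1 by rewrite -expRD subrr expR0.
have elu : expR (l * u) <= 1 + expR u.
  have [u0|u0] := leP 0 u.
    apply: (@le_trans _ _ (expR u)); last by rewrite lerDr.
    by rewrite ler_expR; nra.
  apply: (@le_trans _ _ 1); last by rewrite lerDl expR_ge0.
  by rewrite expR_le1; nra.
have el0 := expR_gt0 (l * u).
have pq2 : 2 <= expR u + expR (- u).
  by have := expR_ge1Dx u; have := expR_ge1Dx (- u); lra.
rewrite -mulrN !e2.
have p0 := expR_gt0 u; have q0 := expR_gt0 (- u).
move: (expR u) (expR (- u)) p0 q0 eN sq elu pq2 => p q p0 q0 eN sq elu pq2.

(* Here [u ^+ 2 <= 2 * (p + q)], and [1 + expR (l * u) <= 2 + p <= 2 * (p + q)] because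
   [p + q >= 2]. *)
have : u ^+ 2 * (1 + expR (l * u)) <= 8 * (p * p + q * q).
  apply: (@le_trans _ _ ((2 * (p + q)) * (2 + p))).
    by apply: ler_pM; rewrite ?sqr_ge0//; lra.
  apply: (@le_trans _ _ (4 * (p + q) ^+ 2)).
    have -> : 4 * (p + q) ^+ 2 = (2 * (p + q)) * (2 * (p + q)) by ring.
    by rewrite ler_pM2l; lra.
  by have := sqr_ge0 (p - q); rewrite !expr2; lra.
move=> H; apply: (le_trans h); rewrite lerD2l exprMn -mulrA.
by apply: ler_wpM2l; rewrite ?sqr_ge0.
Qed.

End expR_bounds.

(** * The tilted law: mean zero and exponential moments *)

Section tilt.
Context (R : realType) (mu : probability R R) (rho delta beta : R).
Hypothesis beta_gt1 : 1 < beta.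
Hypothesis delta_gt0 : 0 < delta.
Hypothesis exp_integrable : forall s, `|s| <= 2 * delta ->
  mu.-integrable setT (EFin \o (fun z => expR ((rho + s) * z))).
Hypothesis exp_min : forall s, `|s| <= 2 * delta ->
  \int[mu]_z (expR (rho * z)) <= \int[mu]_z (expR ((rho + s) * z)).
Hypothesis exp_critical : \int[mu]_z (expR (rho * z)) = beta^-1.

Let beta_gt0 : 0 < beta. Proof. exact: lt_trans beta_gt1. Qed.

Let norm0_le : `|0 : R| <= 2 * delta.
Proof. by rewrite normr0; move: delta_gt0; lra. Qed.

Let normD_le : `|delta| <= 2 * delta.
Proof. by rewrite gtr0_norm; move: delta_gt0; lra. Qed.

Let normND_le : `|- delta| <= 2 * delta.
Proof. by rewrite normrN; exact: normD_le. Qed.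

Let norm2D_le : `|2 * delta| <= 2 * delta.
Proof. by rewrite gtr0_norm; move: delta_gt0; lra. Qed.

Let normN2D_le : `|2 * - delta| <= 2 * delta.
Proof. by rewrite mulrN normrN; exact: norm2D_le. Qed.

(** The density of the tilted law with respect to [mu], of total mass 1 by [exp_critical]; [beta]
    will be the number [b] of children. *)
Definition tilt_density z := beta * expR (rho * z).
Local Notation w := tilt_density.
Definition tilt (f : R -> R) : R := \int[mu]_z (w z * f z).
Definition tilt_integrable (f : R -> R) := mu.-integrable setT (EFin \o (fun z => w z * f z)).

Lemma tilt_density_gt0 z : 0 < w z.
Proof. by apply: mulr_gt0; [exact: beta_gt0|exact: expR_gt0]. Qed.

Lemma tilt_density_exp s z : w z * expR (s * z) = beta * expR ((rho + s) * z).
Proof. by rewrite /tilt_density -mulrA -expRD mulrDl. Qed.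

Lemma measurable_expRM (s : R) : measurable_fun setT (fun z : R => expR (s * z)).
Proof. by apply: measurableT_comp => //; exact: mulrl_measurable. Qed.

Lemma measurable_tilt_density : measurable_fun setT w.
Proof. by apply: measurable_funM => //; exact: measurable_expRM. Qed.

Lemma tilt_integrableD f g : tilt_integrable f -> tilt_integrable g -> tilt_integrable (f \+ g).
Proof.
move=> tf tg; apply: eq_integrable (integrableD measurableT tf tg) => //.
by move=> z _ /=; rewrite -EFinD -mulrDr.
Qed.

Lemma tilt_integrableZ c f : tilt_integrable f -> tilt_integrable (fun z => c * f z).
Proof.
move=> tf; apply: eq_integrable (integrableZl measurableT c tf) => //.
by move=> z _ /=; rewrite -EFinM mulrCA.
Qed.

Lemma tiltD f g : tilt_integrable f -> tilt_integrable g -> tilt (f \+ g) = tilt f + tilt g.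
Proof.
move=> tf tg; rewrite /tilt -RintegralD//.
by apply: eq_Rintegral => z _; rewrite mulrDr.
Qed.

Lemma tiltZ c f : tilt_integrable f -> tilt (fun z => c * f z) = c * tilt f.
Proof.
move=> tf; rewrite /tilt -RintegralZl//.
by apply: eq_Rintegral => z _; rewrite mulrCA.
Qed.

Lemma tilt_le f g : tilt_integrable f -> tilt_integrable g ->
  (forall z, f z <= g z) -> tilt f <= tilt g.
Proof.
move=> tf tg fg; apply: le_Rintegral => // z _.
by rewrite ler_pM2l ?tilt_density_gt0.
Qed.

Lemma tilt_integrable_exp (s : R) : `|s| <= 2 * delta -> tilt_integrable (fun z => expR (s * z)).
Proof.
move=> hs; apply: eq_integrable (integrableZl measurableT beta (exp_integrable hs)) => //.
by move=> z _ /=; rewrite tilt_density_exp.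
Qed.

(** The moment generating function of the tilted law. *)
Definition tilt_exp s := tilt (fun z => expR (s * z)).

Local Notation L := tilt_exp.

Lemma tilt_expE (s : R) : `|s| <= 2 * delta -> L s = beta * \int[mu]_z (expR ((rho + s) * z)).
Proof.
move=> hs; rewrite /tilt_exp /tilt -(RintegralZl beta measurableT (exp_integrable hs)).
by apply: eq_Rintegral => z _; rewrite tilt_density_exp.
Qed.

Lemma tilt_exp0 : L 0 = 1.
Proof.
rewrite tilt_expE//.
by rewrite addr0 exp_critical mulfV// gt_eqF.
Qed.

Lemma tilt_exp_ge1 (s : R) : `|s| <= 2 * delta -> 1 <= L s.
Proof.
move=> hs; rewrite tilt_expE// -ler_pdivrMl//.
by rewrite mulr1 -exp_critical; exact: exp_min.
Qed.

Lemma tilt_integrable_cst c : tilt_integrable (fun=> c).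
Proof.
have h : tilt_integrable (fun z => expR (0 * z)) by exact: tilt_integrable_exp.
by apply: eq_integrable (tilt_integrableZ c h) => // z _ /=; rewrite mul0r expR0 mulr1.
Qed.

Lemma tilt_cst c : tilt (fun=> c) = c.
Proof.
have h : tilt_integrable (fun z => expR (0 * z)) by exact: tilt_integrable_exp.
rewrite -[RHS]mulr1 -tilt_exp0 -(tiltZ c h).
by apply: eq_Rintegral => z _; rewrite mul0r expR0 mulr1.
Qed.

Lemma tilt_integrable_id : tilt_integrable id.
Proof.
have h s : `|s| <= 2 * delta -> tilt_integrable (fun z => expR (s * z)).
  exact: tilt_integrable_exp.
apply: le_integrable (tilt_integrableZ delta^-1
  (tilt_integrableD (h delta _) (h (- delta) _))) => //.
- apply/measurable_EFinP; apply: measurable_funM => //.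
  exact: measurable_tilt_density.
- move=> z _; rewrite !abse_EFin lee_fin normrM [leRHS]normrM ler_wpM2l//=.
  rewrite normrM [X in _ <= _ * X]ger0_norm ?addr_ge0 ?expR_ge0//.
  rewrite normfV ler_pdivlMl ?normr_gt0 ?gt_eqF//.
  by rewrite -normrM mulNr norm_le_cosh.
Qed.

(** [tilt_exp] has its minimum 1 at 0, so its first-order coefficient there, the mean of the tilted
    law, has neither sign. The bound [expR_dominate] replaces differentiation under the integral. *)
Lemma tilt_id : tilt id = 0.
Proof.
pose m := tilt id; pose B := 8 * (L (2 * delta) + L (2 * - delta)).
have B0 : 0 < B.
  have := tilt_exp_ge1 norm2D_le; have := tilt_exp_ge1 normN2D_le.
  by rewrite /B; move: (L _) (L _) => ? ?; lra.
have tE s : `|s| <= 2 * delta -> tilt_integrable (fun z => expR (s * z)).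
  exact: tilt_integrable_exp.
(* Expanding the inequality [1 <= L (e * l * delta)] to first order in [l]. *)
have key e l : `|e| = 1 -> 0 <= l <= 1 -> 0 <= l * (e * delta * m) + l ^+ 2 * B.
  move=> e1 l01.
  have edE : e * delta = delta \/ e * delta = - delta.
    move/eqP: e1; rewrite eqr_norml ler01 andbT => /orP[] /eqP ->; [left|right]; ring.
  have ned : `|l * (e * delta)| <= 2 * delta.
    case/andP: l01 => l0 l1.
    rewrite normrM (ger0_norm l0) normrM e1 mul1r gtr0_norm//.
    by rewrite ler_pM2r//; lra.
  have i1 := tilt_integrable_cst 1.
  have i2 := tilt_integrableZ (l * (e * delta)) tilt_integrable_id.
  have i3 := tilt_integrableZ (l ^+ 2 * 8) (tilt_integrableD (tE _ norm2D_le) (tE _ normN2D_le)).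
  have := tilt_exp_ge1 ned.
  have : L (l * (e * delta)) <= tilt ((cst 1 \+ (fun z => l * (e * delta) * z)) \+
     (fun z => l ^+ 2 * 8 * (expR (2 * delta * z) + expR (2 * - delta * z)))).
    apply: tilt_le => [||z]; first exact: tE.
      exact: tilt_integrableD (tilt_integrableD _ _) _.
    rewrite /=; have -> : l * (e * delta) * z = l * (e * delta * z) by ring.
    have -> : expR (2 * delta * z) + expR (2 * - delta * z) =
        expR (2 * (e * delta * z)) + expR (- (2 * (e * delta * z))).
      by case: edE => ->; last rewrite addrC; congr (expR _ + expR _); ring.
    by rewrite -[_ * 8 * _]mulrA; exact: expR_dominate.
  rewrite (tiltD (tilt_integrableD i1 i2) i3) (tiltD i1 i2) (tiltZ _ tilt_integrable_id).
  rewrite (tiltZ _ (tilt_integrableD (tE _ norm2D_le) (tE _ normN2D_le))).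
  rewrite (tiltD (tE _ norm2D_le) (tE _ normN2D_le)) tilt_cst.
  rewrite -/(L _) -/(L _) -/m /B; move: (L _) (L _) (L _) => ? ? ?; lra.
have small e : `|e| = 1 -> 0 <= e * delta * m.
  move=> e1; rewrite leNgt; apply/negP => neg.
  set v := e * delta * m in neg.
  (* With this [l] the quadratic term is at most half the size of the negative linear one, against
     [key]. *)
  pose l := Num.min 1 ((- v) / (2 * B)).
  have l0 : 0 < l by rewrite lt_min ltr01 divr_gt0 ?oppr_gt0// mulr_gt0.
  have l1 : l <= 1 by rewrite ge_min lexx.
  have lv : l * B <= (- v) / 2.
    rewrite -ler_pdivlMr//; have -> : (- v) / 2 / B = (- v) / (2 * B).
      by rewrite -mulrA -invfM.
    by rewrite ge_min lexx orbT.
  have := key e l e1; rewrite (ltW l0) l1 => /(_ isT); rewrite -/v.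
  nra.
have p1 := small 1 (normr1 _); have p2 := small (-1) (normrN1 _).
apply/eqP; rewrite eq_le -/m; move: p1 p2 delta_gt0 => p1 p2 d0.
by apply/andP; split; nra.
Qed.

(** Equality would make the nonnegative [expR (s * z) - 1 - s * z], of tilted mean zero, vanish
    almost everywhere. Then [z = 0] almost everywhere, and [exp_critical] would give [beta = 1]. *)
Lemma tilt_exp_gt1 (s : R) : `|s| <= 2 * delta -> s != 0 -> 1 < L s.
Proof.
move=> hs s0; rewrite lt_neqAle tilt_exp_ge1// andbT; apply/eqP => L1.
pose f z := expR (s * z) + (-1 + - s * z).
have ti1 : tilt_integrable (fun z => -1 + - s * z).
  exact: (tilt_integrableD (tilt_integrable_cst (-1))
    (tilt_integrableZ (- s) tilt_integrable_id)).
have ti : tilt_integrable f by exact: tilt_integrableD (tilt_integrable_exp hs) ti1.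
have f0 z : 0 <= f z by have := expR_ge1Dx (s * z); rewrite /f; lra.
have tf0 : tilt f = 0.
  rewrite /f (tiltD (tilt_integrable_exp hs) ti1).
  rewrite (tiltD (tilt_integrable_cst _) (tilt_integrableZ _ tilt_integrable_id)).
  rewrite tilt_cst (tiltZ _ tilt_integrable_id).
  by rewrite -/(L s) -L1 tilt_id; lra.
have mwf : measurable_fun setT (fun z => (w z * f z)%:E) by case/integrableP : ti.
have wf0 z : 0 <= w z * f z by rewrite mulr_ge0// ltW// tilt_density_gt0.
have : (\int[mu]_z `|(w z * f z)%:E| = 0)%E.
  have : (\int[mu]_z (w z * f z)%:E = 0)%E.
    by rewrite -(fineK (integrable_fin_num measurableT ti)); congr EFin; exact: tf0.
  by move=> <-; apply: eq_integral => z _; rewrite gee0_abs// lee_fin.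
move=> /(ae_eq_integral_abs mu measurableT mwf) ae0.
have : (\int[mu]_z (expR (rho * z))%:E = \int[mu]_z (cst 1%:E z))%E.
  apply: ae_eq_integral => //.
    by apply/measurable_EFinP; exact: measurable_expRM.
  apply: filterS ae0 => z + _ => /(_ I) [/eqP].
  rewrite mulf_eq0 gt_eqF ?tilt_density_gt0//= => /eqP fz0.
  have [->|z0] := eqVneq z 0; first by rewrite mulr0 expR0.
  by exfalso; have := expR_gt1Dx (mulf_neq0 s0 z0); move: fz0; rewrite /f; lra.
rewrite integral_cst// mul1e (_ : _ setT = 1%E); last exact: probability_setT.
move=> /(congr1 fine) /= h.
have : beta^-1 = 1 by rewrite -exp_critical -h.
by move=> /(congr1 GRing.inv); rewrite invrK invr1 => b1; move: beta_gt1; rewrite b1 ltxx.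
Qed.


Lemma tilt_integrable_ge0 (f g : R -> R) : measurable_fun setT f -> (forall z, 0 <= f z <= g z) ->
  tilt_integrable g -> tilt_integrable f.
Proof.
move=> mf fg; apply: le_integrable => //.
  by apply/measurable_EFinP; apply: measurable_funM => //; exact: measurable_tilt_density.
move=> z _; have /andP[f0 fgz] := fg z; rewrite !abse_EFin lee_fin.
rewrite normrM [leRHS]normrM ler_wpM2l// !ger0_norm//.
exact: le_trans fgz.
Qed.

Lemma tilt_integrable_quasipoly (a c g q s : R) : `|s| <= 2 * delta -> `|2 * s| <= 2 * delta ->
  tilt_integrable (fun z => a + c * z + (g * expR (s * z) + q * expR (2 * s * z))).
Proof.
move=> hs hs2.
have i1 := tilt_integrableD (tilt_integrable_cst a) (tilt_integrableZ c tilt_integrable_id).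
have i2 := tilt_integrableD (tilt_integrableZ g (tilt_integrable_exp hs))
  (tilt_integrableZ q (tilt_integrable_exp hs2)).
exact: (tilt_integrableD i1 i2).
Qed.

(** The affine part contributes only [a] since the tilted law is centered. The truncated functions
    below are compared with functions of this shape, whose second exponential pays for the
    truncation. *)
Lemma tilt_quasipoly (a c g q s : R) : `|s| <= 2 * delta -> `|2 * s| <= 2 * delta ->
  tilt (fun z => a + c * z + (g * expR (s * z) + q * expR (2 * s * z))) =
  a + (g * L s + q * L (2 * s)).
Proof.
move=> hs hs2.
have i1 := tilt_integrableD (tilt_integrable_cst a) (tilt_integrableZ c tilt_integrable_id).
have i2 := tilt_integrableD (tilt_integrableZ g (tilt_integrable_exp hs))
  (tilt_integrableZ q (tilt_integrable_exp hs2)).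
have := tiltD i1 i2.
rewrite (tiltD (tilt_integrable_cst a) (tilt_integrableZ c tilt_integrable_id)).
rewrite tilt_cst (tiltZ c tilt_integrable_id) tilt_id.
rewrite (tiltD (tilt_integrableZ g (tilt_integrable_exp hs))
  (tilt_integrableZ q (tilt_integrable_exp hs2))).
by rewrite (tiltZ g (tilt_integrable_exp hs)) (tiltZ q (tilt_integrable_exp hs2)) mulr0 addr0.
Qed.

(** If steps of size at least [eta] had probability zero, [L delta] would be at most
    [expR (delta * eta)], which by the choice of [eta] is the square root of [L delta > 1]. *)
Lemma step_up_gt0 : exists2 eta : R, 0 < eta & (0 < mu `[eta, +oo[%classic)%E.
Proof.
have L1 : 1 < L delta by apply: tilt_exp_gt1 => //; rewrite gt_eqF.
have lnL : 0 < ln (L delta) by rewrite ln_gt0.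
pose eta := ln (L delta) / (2 * delta).
have eta0 : 0 < eta by rewrite divr_gt0// mulr_gt0.
exists eta => //; rewrite lt0e measure_ge0 andbT; apply/negP => /eqP N0.
have : (\int[mu]_z (w z * expR (delta * z))%:E <=
        \int[mu]_z (w z * expR (delta * eta))%:E)%E.
  apply: ae_ge0_le_integral => //.
  - by move=> z _; rewrite lee_fin mulr_ge0 ?expR_ge0// ltW// tilt_density_gt0.
  - apply/measurable_EFinP; apply: measurable_funM; last exact: measurable_expRM.
    exact: measurable_tilt_density.
  - by move=> z _; rewrite lee_fin mulr_ge0 ?expR_ge0// ltW// tilt_density_gt0.
  - apply/measurable_EFinP; apply: measurable_funM => //; exact: measurable_tilt_density.
  - exists `[eta, +oo[%classic; split => // z /= nz; rewrite in_itv/= andbT leNgt.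
    apply/negP => zeta; apply: nz => _.
    by rewrite lee_fin ler_pM2l ?tilt_density_gt0// ler_expR ler_pM2l// ltW.
rewrite -(fineK (integrable_fin_num measurableT (tilt_integrable_exp normD_le))).
rewrite -(fineK (integrable_fin_num measurableT (tilt_integrable_cst (expR (delta * eta))))).
rewrite lee_fin -[X in X <= _]/(L delta) -[X in _ <= X]/(tilt (fun=> expR (delta * eta))).
rewrite tilt_cst => LE.
have : expR (delta * eta) < L delta.
  rewrite -[ltRHS]lnK ?posrE; last by lra.
  rewrite ltr_expR /eta; have -> : delta * (ln (L delta) / (2 * delta)) = ln (L delta) / 2.
    by field; rewrite gt_eqF.
  by lra.
by rewrite ltNge LE.
Qed.

(** * Super- and subharmonic functions for the killed tilted walk *)

Definition superharmonic A t : R := if 0 <= t then t + A - expR (- delta * t) else 0.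

Lemma measurable_superharmonic A : measurable_fun setT (superharmonic A).
Proof.
apply: measurable_fun_ifT => //.
  by apply: measurable_fun_ler => //; exact: measurable_cst.
apply: measurable_funB; last exact: measurable_expRM.
by apply: measurable_funD => //; exact: measurable_cst.
Qed.

Lemma superharmonic_ge0 A t : 1 <= A -> 0 <= superharmonic A t.
Proof.
move=> A1; rewrite /superharmonic; case: ifPn => // t0.
have : expR (- delta * t) <= 1 by rewrite expR_le1 mulNr oppr_le0 mulr_ge0// ltW.
lra.
Qed.

(** The majorant [g] removes the cut at 0 by adding [q * v ^+ 2], where [v = expR (- delta * t)],
    and its tilted mean is explicit. As [q * K = c], the addition costs [c * e ^+ 2] with
    [e = expR (- delta * y) <= 1], no more than the gain [c * e] from [L (- delta) > 1]. *)
Lemma superharmonic_exists : exists2 A : R, 1 <= A & forall y, 0 <= y ->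
  tilt_integrable (fun z => superharmonic A (y + z)) /\
  tilt (fun z => superharmonic A (y + z)) <= superharmonic A y.
Proof.
pose c := L (- delta) - 1; pose K := L (2 * - delta); pose q := c / K.
have c0 : 0 < c by rewrite subr_gt0; apply: tilt_exp_gt1 => //; rewrite oppr_eq0 gt_eqF.
have K1 : 1 <= K by apply: tilt_exp_ge1.
have K0 : 0 < K by lra.
have q0 : 0 < q by rewrite divr_gt0.
pose D := 1 + delta^-1.
have D0 : 0 < D by rewrite addr_gt0 ?invr_gt0.
(* With [v := expR (- delta * t)], for [t < 0] the bound [le] below follows from
   [q * v ^+ 2 - D * v + A >= 0], whose discriminant is [D ^+ 2 - 4 * q * A]. *)
pose A := Num.max 1 (D ^+ 2 / (4 * q)).
have A1 : 1 <= A by rewrite le_max lexx.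
have AD : D ^+ 2 <= A * (4 * q).
  by rewrite -ler_pdivrMr; [rewrite /A le_max lexx orbT|exact: mulr_gt0].
exists A => // y y0.
pose g z := y + A + 1 * z + (- expR (- delta * y) * expR (- delta * z) +
   q * expR (- delta * y) ^+ 2 * expR (2 * - delta * z)).
have gE z : g z = y + z + A - expR (- delta * (y + z)) + q * expR (- delta * (y + z)) ^+ 2.
  by rewrite /g mulrDr expRD exprMn -[expR (- delta * z) ^+ 2]expRM_natl !mulrA; ring.
have ti : tilt_integrable g by exact: tilt_integrable_quasipoly.
have le z : superharmonic A (y + z) <= g z.
  rewrite gE /superharmonic; case: ifPn => [_|]; first by rewrite lerDl mulr_ge0// ?sqr_ge0// ltW.
  rewrite -ltNge; set t := y + z => t0.
  have := expR_ge1Dx (- delta * t); set v := expR _ => v1.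
  have tv : - t <= v / delta.
    by rewrite ler_pdivlMr//; lra.
  have h : 0 <= (2 * q * v - D) ^+ 2 by exact: sqr_ge0.
  have h2 : 0 <= 4 * q * (A - D * v + q * v ^+ 2) by move: h; rewrite !expr2 in AD *; lra.
  rewrite pmulr_rge0 in h2; last exact: mulr_gt0.
  move: h2; rewrite /D mulrDl mul1r [_^-1 * _]mulrC; lra.
have ti' : tilt_integrable (fun z => superharmonic A (y + z)).
  apply: tilt_integrable_ge0 ti => [|z].
    apply: measurableT_comp (measurable_superharmonic A) _.
    exact: measurable_funD.
  by rewrite superharmonic_ge0//= le.
split => //; apply: (le_trans (tilt_le ti' ti le)).
rewrite tilt_quasipoly// -/K /superharmonic y0.
have e1 : expR (- delta * y) <= 1 by rewrite expR_le1 mulNr oppr_le0 mulr_ge0// ltW.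
have e0 := expR_gt0 (- delta * y).
move: e1 e0; set e := expR _ => e1 e0.
have -> : L (- delta) = c + 1 by rewrite /c; ring.
have -> : q * e ^+ 2 * K = c * e ^+ 2 by rewrite /q; field; rewrite gt_eqF.
have : c * e ^+ 2 <= c * e by rewrite ler_pM2l// expr2 ger_pMl.
lra.
Qed.


(** The subtracted constant makes the formula vanish at 0, hence nonpositive below 0, where the cut
    can then only increase it. The cut at [k + m] keeps the function of order [k]. *)
Definition subharmonic k m t : R :=
  if (0 <= t) && (t <= k + m)
  then t + k * expR (delta * (t - k)) - k * expR (- (delta * k)) else 0.

Lemma measurable_subharmonic k m : measurable_fun setT (subharmonic k m).
Proof.
apply: measurable_fun_ifT => //.
  apply: measurable_and; apply: measurable_fun_ler => //; exact: measurable_cst.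
apply: measurable_funB; last exact: measurable_cst.
apply: measurable_funD => //; apply: measurable_funM; first exact: measurable_cst.
apply: measurableT_comp => //; apply: measurable_funM; first exact: measurable_cst.
by apply: measurable_funB => //; exact: measurable_cst.
Qed.

Lemma subharmonic_ge k m t : 0 <= k -> 0 <= t <= k + m -> t <= subharmonic k m t.
Proof.
move=> k0 tkm; rewrite /subharmonic tkm; case/andP: tkm => t0 _.
rewrite -addrA lerDl subr_ge0 ler_wpM2l// ler_expR mulrBr.
by rewrite lerDr mulr_ge0// ltW.
Qed.

Lemma subharmonic_ge0 k m t : 0 <= k -> 0 <= subharmonic k m t.
Proof.
move=> k0; have [tkm|ntkm] := boolP ((0 <= t) && (t <= k + m)).
  by apply: le_trans (subharmonic_ge k0 tkm); case/andP: tkm.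
by rewrite /subharmonic (negbTE ntkm).
Qed.

Lemma linear_le_exp k t : 1 <= k -> k <= t ->
  t + k * expR (delta * (t - k)) <= k * ((2 + delta^-1) * expR (delta * (t - k))).
Proof.
move=> k1 kt; set E := expR _.
have EE : 1 + delta * (t - k) <= E by exact: expR_ge1Dx.
have dt : 0 <= delta * (t - k) by rewrite mulr_ge0 ?subr_ge0// ltW.
have h1 : t - k <= E / delta by rewrite ler_pdivlMr// mulrC; lra.
have h2 : 0 <= (k - 1) * (E / delta).
  by rewrite mulr_ge0 ?divr_ge0 ?subr_ge0 ?expR_ge0// ltW.
have h3 : 0 <= k * (E - 1) by rewrite mulr_ge0; lra.
have -> : k * ((2 + delta^-1) * E) = 2 * (k * E) + k * (E / delta) by ring.
move: h1 h2 h3; set F := E / delta; lra.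
Qed.

Lemma subharmonic_le k m t : 1 <= k -> 0 <= m ->
  subharmonic k m t <= k * ((2 + delta^-1) * expR (delta * m)).
Proof.
move=> k1 m0; have D0 : 0 < 2 + delta^-1 by rewrite addr_gt0 ?invr_gt0.
have k0 : 0 < k by lra.
have a0 : 0 <= k * expR (- (delta * k)) by rewrite mulr_ge0 ?expR_ge0// ltW.
have dm : 1 <= expR (delta * m) by rewrite -[leLHS]expR0 ler_expR mulr_ge0// ltW.
rewrite /subharmonic; case: ifPn => [/andP[t0 tkm]|_]; last first.
  by rewrite !mulr_ge0 ?expR_ge0// ltW.
have [kt|tk] := leP k t.
  apply: (@le_trans _ _ (k * ((2 + delta^-1) * expR (delta * (t - k))))).
    by have := linear_le_exp k1 kt; lra.
  by rewrite !ler_pM2l// ler_expR ler_pM2l//; lra.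
apply: (@le_trans _ _ (k * 2)).
  have : k * expR (delta * (t - k)) <= k * 1.
    by rewrite ler_pM2l// expR_le1 mulr_ge0_le0// ?subr_le0 ltW.
  lra.
rewrite ler_pM2l//; apply: (@le_trans _ _ ((2 + delta^-1) * 1)).
  by rewrite mulr1 lerDl invr_ge0 ltW.
by rewrite ler_pM2l.
Qed.

(** The minorant [g] subtracts [q * k * E ^+ 2], with [E = expR (delta * (t - k))], which beyond
    [k + m] outweighs the rest and so allows the cut. Half of the gain [L delta - 1] pays for it;
    the other half is the [c] of the statement. *)
Lemma subharmonic_exists : exists m c : R, [/\ 0 <= m, 0 < c &
  forall k y, 1 <= k -> 0 <= y < k ->
    tilt_integrable (fun z => subharmonic k m (y + z)) /\
    y + (1 + c) * (k * expR (delta * (y - k))) - k * expR (- (delta * k))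
      <= tilt (fun z => subharmonic k m (y + z))].
Proof.
pose c := L delta - 1; pose K := L (2 * delta); pose q := c / (2 * K).
have c0 : 0 < c by rewrite subr_gt0; apply: tilt_exp_gt1 => //; rewrite gt_eqF.
have K1 : 1 <= K by apply: tilt_exp_ge1.
have K0 : 0 < K by lra.
have q0 : 0 < q by rewrite divr_gt0// mulr_gt0.
pose D := 2 + delta^-1.
have D0 : 0 < D by rewrite addr_gt0 ?invr_gt0.
(* Chosen for [Em], through [expR v >= 1 + v]. *)
pose m := D / q / delta.
have m0 : 0 <= m by rewrite /m !mulr_ge0 ?invr_ge0// ltW.
have Em : D <= q * expR (delta * m).
  have := expR_ge1Dx (delta * m).
  have -> : delta * m = D / q by rewrite /m; field; rewrite !gt_eqF.
  move=> h; apply: (@le_trans _ _ (q * (D / q))).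
    by rewrite mulrCA divff ?mulr1// gt_eqF.
  by rewrite ler_pM2l//; lra.
exists m, (c / 2); split => //; first by rewrite divr_gt0.
move=> k y k1 /andP[y0 yk].
have k0 : 0 < k by lra.
pose e := expR (delta * (y - k)).
have e0 : 0 < e by exact: expR_gt0.
have e1 : e <= 1 by rewrite expR_le1 mulr_ge0_le0 ?subr_le0// ltW.
pose a := k * expR (- (delta * k)).
pose g z := y - a + 1 * z + (k * e * expR (delta * z) +
   - (q * k * e ^+ 2) * expR (2 * delta * z)).
have gE z : g z = y + z + k * expR (delta * (y + z - k)) - a
    - q * k * expR (delta * (y + z - k)) ^+ 2.
  have -> : delta * (y + z - k) = delta * (y - k) + delta * z by ring.
  by rewrite /g expRD -/e exprMn -[expR (delta * z) ^+ 2]expRM_natl !mulrA; ring.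
have ti : tilt_integrable g by exact: tilt_integrable_quasipoly.
have le z : g z <= subharmonic k m (y + z).
  rewrite gE; set t := y + z; set E := expR (delta * (t - k)).
  have E0 : 0 < E by exact: expR_gt0.
  have P0 : 0 <= q * k * E ^+ 2 by exact: mulr_ge0 (ltW (mulr_gt0 q0 k0)) (sqr_ge0 E).
  rewrite /subharmonic; case: ifPn => [_|]; first by rewrite -/a -/E; lra.
  rewrite negb_and -!ltNge => /orP[tlt|tgt].
    have : k * E <= a by rewrite ler_pM2l// ler_expR mulrBr gerDr mulr_ge0_le0// ltW.
    lra.
  have a0 : 0 <= a by rewrite mulr_ge0 ?expR_ge0// ltW.
  have r0 : 0 <= t - k by lra.
  have DE : D <= q * E.
    by apply: (le_trans Em); rewrite ler_pM2l// ler_expR ler_pM2l//; lra.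
  have kt : k <= t by lra.
  have := linear_le_exp k1 kt; rewrite -/E -/D.
  have : k * (D * E) <= k * (q * E * E) by rewrite ler_pM2l// ler_pM2r.
  rewrite expr2; have -> : q * k * (E * E) = k * (q * E * E) by ring.
  move: a0 => /[swap] /[swap]; lra.
have ti' : tilt_integrable (fun z => subharmonic k m (y + z)).
  apply: tilt_integrable_ge0 (tilt_integrable_cst (k * (D * expR (delta * m)))) => [|z].
    apply: measurableT_comp (measurable_subharmonic k m) _.
    exact: measurable_funD.
  by apply/andP; split; [exact: subharmonic_ge0 (ltW k0)|exact: subharmonic_le].
split => //; apply: le_trans (tilt_le ti ti' le).
rewrite tilt_quasipoly// -/K -/e -/a.
have -> : L delta = c + 1 by rewrite /c; ring.
have -> : - (q * k * e ^+ 2) * K = - (c / 2 * (k * e * e)).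
  by rewrite /q; field; rewrite gt_eqF.
have : c / 2 * (k * e * e) <= c / 2 * (k * e).
  by rewrite ler_pM2l ?divr_gt0// ger_pMr ?mulr_gt0.
lra.
Qed.

End tilt.

(** * Two-sided bounds for finitely many generations *)

(** Second-order inclusion-exclusion for [n] independent events of probability [q], with a cruder
    quadratic term. *)
Lemma bernoulli_quadratic (R : realType) (n : nat) (q : R) : 0 <= q <= 1 ->
  n%:R * q - (n%:R * q) ^+ 2 <= 1 - (1 - q) ^+ n.
Proof.
move=> /andP[q0 q1]; elim: n => [|n IH].
  by rewrite expr0 mul0r expr0n/=; lra.
have h : (1 - q) * (1 - q) ^+ n <= (1 - q) * (1 - n%:R * q + (n%:R * q) ^+ 2).
  by rewrite ler_wpM2l//; lra.
rewrite [(1 - q) ^+ n.+1]exprS -natr1; apply: (le_trans _ (lerB (lexx 1) h)).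
have n0 : 0 <= n%:R :> R by [].
have h1 : 0 <= n%:R * (q * q) by rewrite !mulr_ge0.
have h2 : 0 <= (n%:R * q) ^+ 2 * q by rewrite mulr_ge0 ?sqr_ge0.
have h3 : 0 <= q * q by rewrite mulr_ge0.
rewrite !expr2 in h2 *; lra.
Qed.

Lemma bernoulli_ge (R : realType) (n : nat) (x : R) : 0 <= x -> n%:R * x <= (1 + x) ^+ n.
Proof.
move=> x0; suff : 1 + n%:R * x <= (1 + x) ^+ n by lra.
elim: n => [|n IH]; first by rewrite expr0 mul0r addr0.
have h : (1 + x) * (1 + n%:R * x) <= (1 + x) * (1 + x) ^+ n by rewrite ler_wpM2l//; lra.
rewrite exprS -natr1; apply: (le_trans _ h).
have : 0 <= n%:R * (x * x) by rewrite !mulr_ge0.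
lra.
Qed.

Lemma exists_mulrn_ge (R : realType) (e x : R) : 0 < e -> exists m : nat, x <= m%:R * e.
Proof.
move=> e0; exists (Num.truncn (x / e)).+1; rewrite -ler_pdivrMr//.
exact/ltW/truncnS_gt.
Qed.

Section bounds.
Context (R : realType) (b : nat) (d : measure_display) (T : measurableType d)
  (P : probability T R) (mu : probability R R) (rho delta : R).
Implicit Types (X : vertex b -> {RV P >-> R}) (k y z : R).
Hypothesis b_gt1 : (1 < b)%N.
Hypothesis delta_gt0 : 0 < delta.
Hypothesis delta_le_rho : delta <= rho.
Hypothesis exp_integrable : forall s, `|s| <= 2 * delta ->
  mu.-integrable setT (EFin \o (fun z => expR ((rho + s) * z))).
Hypothesis exp_min : forall s, `|s| <= 2 * delta ->
  \int[mu]_z (expR (rho * z)) <= \int[mu]_z (expR ((rho + s) * z)).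
Hypothesis exp_critical : \int[mu]_z (expR (rho * z)) = b%:R^-1.

Let iid X := iid_with_law [set u | u <> tree_root b] X mu.
Let beta_gt1 : 1 < b%:R :> R. Proof. by rewrite ltr1n. Qed.
Local Notation tilt := (tilt mu rho b%:R).
Local Notation tilt_integrable := (tilt_integrable mu rho b%:R).

(** The change of measure: the factor [expR (rho * z)] is absorbed into the tilted density, and the
    remaining [1 / b] will cancel the number of children. *)
Lemma integral_exp_mul (C k y : R) (f : R -> R) : tilt_integrable (fun z => f (y + z)) ->
  (\int[mu]_z (C * expR (rho * (y + z - k)) * f (y + z))%:E =
   (C * expR (rho * (y - k)) * tilt (fun z => f (y + z)) / b%:R)%:E)%E.
Proof.
move=> tf; have b0 : b%:R != 0 :> R by rewrite gt_eqF// (lt_trans ltr01).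
transitivity (\int[mu]_z ((C * expR (rho * (y - k)) / b%:R)%:E *
    (tilt_density rho b%:R z * f (y + z))%:E))%E.
  apply: eq_integral => z _; rewrite -EFinM /tilt_density; congr EFin.
  have -> : rho * (y + z - k) = rho * (y - k) + rho * z by ring.
  by rewrite expRD; field.
rewrite integralZl//.
rewrite -(fineK (integrable_fin_num measurableT tf)) -EFinM; congr EFin.
by rewrite -[fine _]/(tilt _); ring.
Qed.

(** The supersolution is [expR (rho * (t - k)) / k] times [superharmonic]; the latter lies between
    [t] and [t + A], so [h] is at least 1 beyond [k]. *)
Lemma prob_reach_upper : exists2 A : R, 1 <= A &
  forall X n k y, iid X -> 0 < k -> 0 <= y ->
    (P [set w | reach n (X^~ w) k y]
      <= (A * (1 + y) * (expR (rho * (y - k)) / k))%:E)%E.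
Proof.
have [A A1 superA] := superharmonic_exists beta_gt1 delta_gt0 exp_integrable
  exp_min exp_critical.
exists A => // X n k y iX k0 y0.
pose h t := k^-1 * expR (rho * (t - k)) * superharmonic delta A t.
have kV0 : 0 < k^-1 by rewrite invr_gt0.
have sle t : 0 <= t -> t <= superharmonic delta A t <= t + A.
  move=> t0; rewrite /superharmonic t0.
  have := expR_ge0 (- delta * t).
  have : expR (- delta * t) <= 1 by rewrite expR_le1 mulNr oppr_le0 mulr_ge0// ltW.
  by move=> ? ?; apply/andP; split; lra.
have mh : measurable_fun setT h.
  apply: measurable_funM; last exact: measurable_superharmonic.
  apply: measurable_funM => //; apply: measurableT_comp => //.
  by apply: measurable_funM => //; apply: measurable_funB.
have h0 t : 0 <= h t.
  by rewrite mulr_ge0 ?superharmonic_ge0// mulr_ge0 ?expR_ge0// ltW.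
apply: (@le_trans _ _ (h y)%:E); last first.
  have -> : A * (1 + y) * (expR (rho * (y - k)) / k) =
      k^-1 * expR (rho * (y - k)) * (A * (1 + y)) by ring.
  rewrite lee_fin ler_wpM2l ?mulr_ge0 ?expR_ge0 ?(ltW kV0)//.
  have /andP[_ s2] := sle _ y0; apply: (le_trans s2).
  have : 0 <= (A - 1) * y by rewrite mulr_ge0 ?subr_ge0.
  lra.
apply: (@reach_le_supersolution _ _ _ _ P mu h k) => //.
- move=> t kt; have t0 : 0 <= t by rewrite (le_trans _ kt)// ltW.
  apply: (@le_trans _ _ (k^-1 * 1 * k)); first by rewrite mulr1 mulVf// gt_eqF.
  have /andP[s1 _] := sle _ t0.
  apply: ler_pM; [by rewrite mulr1 ltW|exact: ltW| |exact: le_trans s1].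
  rewrite ler_pM2l// -[leLHS]expR0 ler_expR mulr_ge0 ?subr_ge0//.
  exact: le_trans (ltW delta_gt0) delta_le_rho.
- move=> t t0 tk; have [ti tle] := superA t t0.
  rewrite integral_exp_mul// -EFinM lee_fin mulrC divfK; last by rewrite gt_eqF// (lt_trans ltr01).
  by rewrite ler_wpM2l// mulr_ge0 ?expR_ge0// ltW.
Qed.

(** One line of descent is followed through [m] steps of size at least [eta]; each costs a factor
    [mu [eta, +oo[] and the walk stays nonnegative. *)
Lemma reach_climb (eta q a k : R) (n : nat) : 0 < eta -> 0 <= q ->
    (forall X, iid X -> forall y, a <= y ->
       (q%:E <= P [set w | reach n (X^~ w) k y])%E) ->
  forall m X y, iid X -> 0 <= y -> a <= y + m%:R * eta ->
    ((fine (mu `[eta, +oo[%classic) ^+ m * q)%:E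
       <= P [set w | reach (n + m) (X^~ w) k y])%E.
Proof.
move=> eta0 q0 base; set p := fine _.
have p0 : 0 <= p by rewrite fine_ge0.
have pE : mu `[eta, +oo[%classic = p%:E by rewrite fineK// fin_num_measure.
elim=> [|m IH] X y iX y0 ay.
  by rewrite expr0 mul1r addn0; apply: base => //; move: ay; rewrite mul0r addr0.
have i0 : 'I_b by exact: Ordinal (ltnW b_gt1).
rewrite addnS.
apply: (@le_trans _ _ (P (child_reach X (n + m) k y i0))); last first.
  apply: le_measure; rewrite ?inE; last exact: child_reach_sub_reach.
    exact: child_reach_measurable.
  exact: reach_measurable.
rewrite (child_reach_integral iX).
have c0 : 0 <= p ^+ m * q by rewrite mulr_ge0 ?exprn_ge0.
have mI : measurable_fun setT (fun z : R => (\1_(`[eta, +oo[%classic) z : R)).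
  by apply: measurable_indic; exact: measurable_itv.
have int1 : (\int[mu]_z ((\1_(`[eta, +oo[%classic) z)%:E) = p%:E)%E.
  by rewrite integral_indic ?setIT//; exact: pE.
apply: (@le_trans _ _ (\int[mu]_z ((p ^+ m * q)%:E * (\1_(`[eta, +oo[%classic) z)%:E))%E).
  rewrite ge0_integralZl//; last exact/measurable_EFinP.
  by rewrite int1 -EFinM lee_fin exprS -mulrA mulrC.
apply: ge0_le_integral => //.
- by move=> z _; rewrite mule_ge0// lee_fin.
- by apply: measurable_funeM; exact/measurable_EFinP.
- exact: prob_reach_measurable.
- move=> z _; rewrite -EFinM indicE; case: (boolP (z \in _)) => [|_]; last by rewrite mulr0.
  rewrite inE/= in_itv/= andbT mulr1 => ez; apply: IH.
  + exact: subtree_iid.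
  + by rewrite addr_ge0// (le_trans _ ez)// ltW.
  + apply: (le_trans ay); rewrite -natr1 mulrDl mul1r; lra.
Qed.


Lemma probability_le1_fine (A : set R) : measurable A -> 0 <= fine (mu A) <= 1.
Proof.
move=> mA; rewrite fine_ge0//= -lee_fin fineK ?fin_num_measure//.
exact: probability_le1.
Qed.

(** [h] is [eps / k * expR (rho * (t - k))] times [subharmonic]. Only [eps] has to be uniform in
    [k]; the strict improvement [kap] may depend on [k], since it merely governs how many
    generations are needed. *)
Lemma subsolution_exists : exists2 eps : R, 0 < eps & forall k, 1 <= k ->
  exists (h : R -> R) (kap : R), [/\ measurable_fun setT h /\ (forall y, 0 <= h y <= 1),
    0 < kap, forall y, y < 0 -> h y = 0,
    forall y, 0 <= y <= k -> eps * y * (expR (rho * (y - k)) / k) <= h y &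
    forall y, 0 <= y < k -> exists2 q : R, 0 <= q <= 1 &
      (q%:E = \int[mu]_z (h (y + z))%:E)%E /\
      (1 + kap) * h y <= b%:R * q - (b%:R * q) ^+ 2].
Proof.
have [m [c [m0 c0 subH]]] := subharmonic_exists beta_gt1 delta_gt0 exp_integrable
  exp_min exp_critical.
have rho0 : 0 < rho by exact: lt_le_trans delta_le_rho.
pose C := (2 + delta^-1) * expR (delta * m).
have C1 : 1 <= C.
  have h1 : 0 <= delta^-1 by rewrite invr_ge0 ltW.
  have h2 : 1 <= expR (delta * m) by rewrite -[leLHS]expR0 ler_expR mulr_ge0// ltW.
  by apply: (@le_trans _ _ (1 * 1)); [rewrite mulr1|apply: ler_pM => //; lra].
have C0 : 0 < C by lra.
(* The first term ensures [h <= 1], the second that the quadratic loss takes at most half of the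
   gain [c * (k * E)]. *)
pose eps := Num.min (expR (- (rho * m)) / C) (c / 2 / (C * C)).
have eps0 : 0 < eps by rewrite lt_min !divr_gt0 ?expR_gt0// mulr_gt0.
have eps1 : eps * expR (rho * m) * C <= 1.
  apply: (@le_trans _ _ (expR (- (rho * m)) / C * expR (rho * m) * C)).
    by rewrite !ler_pM2r ?expR_gt0// /eps ge_min lexx.
  by rewrite mulrAC divfK ?gt_eqF// -expRD addNr expR0.
have eps2 : eps * (C * C) <= c / 2.
  by rewrite -ler_pdivlMr; [rewrite /eps ge_min lexx orbT|exact: mulr_gt0].
have rm1 : 1 <= expR (rho * m) by rewrite -[leLHS]expR0 ler_expR mulr_ge0// ltW.
have epsC : eps * C <= 1.
  apply: le_trans eps1; rewrite mulrAC -[leLHS]mulr1.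
  by rewrite ler_pM2l; [exact: rm1|exact: mulr_gt0].
exists eps => // k k1; have k0 : 0 < k by lra.
pose psi := subharmonic delta k m.
have psi0 t : 0 <= psi t by exact: subharmonic_ge0 (ltW k0).
have psiC t : psi t <= k * C by exact: subharmonic_le.
have psi_km t : ~~ (0 <= t <= k + m) -> psi t = 0.
  by rewrite /psi /subharmonic => /negbTE ->.
pose h t := eps / k * expR (rho * (t - k)) * psi t.
(* Small enough for [kap * G] to fit in the other half of the gain, [G] being at most [2 * k]. *)
pose kap := c / 4 * expR (- (delta * k)).
have ek0 : 0 < eps / k by rewrite divr_gt0.
exists h, kap; split.
- split.
    apply: measurable_funM; last exact: measurable_subharmonic.
    apply: measurable_funM => //; apply: measurableT_comp => //.
    by apply: measurable_funM => //; apply: measurable_funB.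
  move=> t; apply/andP; split.
    by rewrite mulr_ge0// mulr_ge0 ?expR_ge0// ltW.
  have [tkm|/psi_km pt0] := boolP (0 <= t <= k + m); last by rewrite /h pt0 mulr0.
  apply: (@le_trans _ _ (eps / k * expR (rho * m) * (k * C))).
    apply: ler_pM => //; first by rewrite mulr_ge0 ?expR_ge0// ltW.
    by rewrite ler_pM2l// ler_expR ler_pM2l//; lra.
  by apply: le_trans eps1; rewrite le_eqVlt; apply/orP; left; apply/eqP; field; rewrite gt_eqF.
- by rewrite mulr_gt0 ?expR_gt0// divr_gt0.
- by move=> t t0; rewrite /h psi_km ?mulr0// negb_and -ltNge t0.
- move=> t tk; rewrite /h.
  have -> : eps * t * (expR (rho * (t - k)) / k) = eps / k * expR (rho * (t - k)) * t by ring.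
  apply: ler_wpM2l; first by rewrite mulr_ge0 ?expR_ge0// ltW.
  by apply: (subharmonic_ge delta_gt0 (ltW k0)); lra.
move=> y /andP[y0 yk].
have [ti tle] : tilt_integrable (fun z => psi (y + z)) /\
    y + (1 + c) * (k * expR (delta * (y - k))) - k * expR (- (delta * k))
      <= tilt (fun z => psi (y + z)) by apply: subH => //; rewrite y0.
have b0 : 0 < b%:R :> R by exact: lt_trans ltr01 beta_gt1.
set p := tilt _ in tle.
have p0 : 0 <= p.
  apply: Rintegral_ge0 => z _; rewrite mulr_ge0//.
  by rewrite ltW// tilt_density_gt0.
have pC : p <= k * C.
  rewrite -[leRHS](tilt_cst beta_gt1 delta_gt0 exp_integrable exp_critical).
  apply: (tilt_le beta_gt1 ti) => //.
  exact: (@tilt_integrable_cst _ mu rho delta b%:R delta_gt0 exp_integrable (k * C)).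
pose e := expR (rho * (y - k)); pose E := expR (delta * (y - k)).
have e0 : 0 < e by exact: expR_gt0.
have eE : e <= E by rewrite ler_expR ler_wnM2r ?subr_le0// ltW.
have E0 : 0 < E by exact: expR_gt0.
have E1 : E <= 1 by rewrite -[leRHS]expR0 ler_expR mulr_ge0_le0 ?subr_le0// ltW.
pose a := eps / k * e.
have a0 : 0 < a by rewrite mulr_gt0.
have ap : a * p <= eps * C * e.
  apply: (@le_trans _ _ (a * (k * C))); first by rewrite ler_pM2l.
  by rewrite le_eqVlt; apply/orP; left; apply/eqP; rewrite /a; field; rewrite gt_eqF.
have ap1 : a * p <= 1.
  apply: (le_trans ap); rewrite -[leRHS]mulr1; apply: ler_pM => //.
  - by rewrite mulr_ge0// ltW.
  - exact: ltW.
  - exact: le_trans E1.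
have qb : b%:R * (a * p / b%:R) = a * p by rewrite mulrC divfK// gt_eqF.
exists (a * p / b%:R).
  apply/andP; split; first exact: divr_ge0 (mulr_ge0 (ltW a0) p0) (ltW b0).
  by rewrite ler_pdivrMr// mul1r (le_trans ap1)// ltW.
split; first by rewrite integral_exp_mul.
rewrite qb.
pose F := expR (- (delta * k)).
have FE : F <= E by rewrite ler_expR mulrBr lerDr mulr_ge0// ltW.
have F0 : 0 < F by exact: expR_gt0.
pose G := y + k * E - k * F.
have hy : h y = a * G.
  by rewrite /h /psi /subharmonic y0 (le_trans (ltW yk))// lerDl.
have app : a * p * p <= c / 2 * (k * E).
  apply: (@le_trans _ _ (eps * C * E * (k * C))).
    apply: ler_pM => //; first by rewrite mulr_ge0// ltW.
    by apply: (le_trans ap); rewrite ler_pM2l// mulr_gt0.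
  have -> : eps * C * E * (k * C) = eps * (C * C) * (k * E) by ring.
  by rewrite ler_pM2r// mulr_gt0.
have kG : kap * G <= c / 2 * (k * E).
  have kap0 : 0 < kap by rewrite mulr_gt0// divr_gt0.
  apply: (@le_trans _ _ (kap * (2 * k))).
    rewrite ler_pM2l//; have : k * E <= k * 1 by rewrite ler_pM2l.
    have : 0 <= k * F by rewrite mulr_ge0// ltW.
    rewrite /G; lra.
  have -> : kap * (2 * k) = c / 2 * (k * F) by rewrite /kap -/F; field.
  by rewrite !ler_pM2l// divr_gt0.
rewrite hy expr2; have -> : (1 + kap) * (a * G) = a * (G + kap * G) by ring.
have -> : a * p - a * p * (a * p) = a * (p - a * p * p) by ring.
rewrite ler_pM2l//; move: tle; rewrite -/E -/F.
have -> : y + (1 + c) * (k * E) - k * F = G + c / 2 * (k * E) + c / 2 * (k * E).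
  by rewrite /G; field.
by move: app kG; lra.
Qed.


(* The lower bound [th * h] improves by the factor [1 + kap] at each generation,
   so that it reaches [h] itself from any [th > 0]. *)
Lemma prob_reach_scale_step (h : R -> R) (kap k th : R) (n : nat) :
    0 <= k -> measurable_fun setT h -> (forall y, 0 <= h y <= 1) ->
    (forall y, y < 0 -> h y = 0) ->
    (forall y, 0 <= y < k -> exists2 q : R, 0 <= q <= 1 &
      (q%:E = \int[mu]_z (h (y + z))%:E)%E /\
      (1 + kap) * h y <= b%:R * q - (b%:R * q) ^+ 2) ->
    0 <= th <= 1 ->
    (forall X, iid X -> forall y, ((th * h y)%:E <= P [set w | reach n (X^~ w) k y])%E) ->
  forall X, iid X -> forall y,
    ((Num.min 1 (th * (1 + kap)) * h y)%:E <= P [set w | reach n.+1 (X^~ w) k y])%E.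
Proof.
move=> k0 mh h01 hneg hsub /andP[th0 th1] IH X iX y.
have [y0|y0] := ltP y 0; first by rewrite hneg// mulr0.
have /andP[hy0 hy1] := h01 y.
have [ky|yk] := leP k y.
  rewrite prob_reach_eq1// lee_fin -[leRHS]mulr1.
  apply: (@le_trans _ _ (1 * h y)); last by rewrite ler_wpM2l.
  by rewrite ler_wpM2r// ge_min lexx.
have [|q /andP[q0 q1] [qE qsub]] := hsub y; first by rewrite y0.
have thq : 0 <= th * q <= 1.
  by rewrite mulr_ge0//= -[leRHS]mulr1 ler_pM.
apply: le_trans (@prob_reach_step_ge R b d T P mu (fun z => th * h z) k n y (th * q) X
  _ _ IH iX y0 thq _).
- rewrite lee_fin; apply: le_trans (bernoulli_quadratic b thq).
  apply: (@le_trans _ _ (th * ((1 + kap) * h y))).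
    by rewrite mulrA ler_wpM2r// ge_min lexx orbT.
  apply: (@le_trans _ _ (th * (b%:R * q - (b%:R * q) ^+ 2))); first by rewrite ler_wpM2l.
  have : 0 <= th * (1 - th) * (b%:R * q) ^+ 2.
    by rewrite !mulr_ge0 ?sqr_ge0// subr_ge0.
  rewrite !exprMn !expr2; move: (b%:R : R) => B; lra.
- by apply: measurable_funM.
- by move=> z; rewrite mulr_ge0//; case/andP: (h01 z).
- under eq_integral do rewrite EFinM.
  rewrite ge0_integralZl//.
  + by rewrite EFinM lee_wpmul2l// qE.
  + apply/measurable_EFinP; apply: measurableT_comp mh _; exact: measurable_funD.
  + by move=> z _; rewrite lee_fin; case/andP: (h01 (y + z)).
Qed.

(** A crude climb to [k] gives [th0 * h] as a first lower bound, which is then amplified to [h] in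
    finitely many generations. The inequality on [eps] is [h 1 <= 1] weakened; it lets the bound at
    height 1 serve for starts beyond [k] as well. *)
Lemma prob_reach_interior : exists2 eps : R, 0 < eps & forall k, 1 <= k ->
  exists2 n : nat, eps * expR (rho * (1 - k)) / k <= 1 & forall X, iid X ->
    forall y, 0 <= y <= k ->
    ((eps * y * (expR (rho * (y - k)) / k))%:E <= P [set w | reach n (X^~ w) k y])%E.
Proof.
have [eps eps0 sub] := subsolution_exists.
have [eta eta0 peta] := step_up_gt0 beta_gt1 delta_gt0 exp_integrable exp_min exp_critical.
exists eps => // k k1; have k0 : 0 < k by lra.
have [h [kap [[mh h01] kap0 hneg hge hsub]]] := sub k k1.
have [n0 n0k] := exists_mulrn_ge k eta0.
set p := fine (mu `[eta, +oo[%classic).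
have p0 : 0 < p by rewrite fine_gt0// peta ltey_eq fin_num_measure.
have p1 : p <= 1 by have /andP[] := @probability_le1_fine `[eta, +oo[%classic (measurable_itv _).
pose th0 := p ^+ n0.
have th00 : 0 < th0 by exact: exprn_gt0.
have th01 : th0 <= 1 by rewrite exprn_ile1// ltW.
have base X : iid X -> forall y,
    ((th0 * h y)%:E <= P [set w | reach n0 (X^~ w) k y])%E.
  move=> iX y; have [y0|y0] := ltP y 0; first by rewrite hneg// mulr0.
  have /andP[hy0 hy1] := h01 y.
  apply: (@le_trans _ _ (th0 * 1)%:E); first by rewrite lee_fin ler_pM2l.
  apply: (@reach_climb eta 1 k k 0) => //; last by apply: (le_trans n0k); lra.
  by move=> X' _ y' ky'; rewrite prob_reach_eq1// (le_trans _ ky')// ltW.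
have iter_ub n X : iid X -> forall y,
    ((Num.min 1 (th0 * (1 + kap) ^+ n) * h y)%:E <= P [set w | reach (n0 + n) (X^~ w) k y])%E.
  elim: n X => [|n IH] X iX y.
    by rewrite expr0 mulr1 min_r// addn0; exact: base.
  have r0 : 0 <= th0 * (1 + kap) ^+ n by rewrite mulr_ge0 ?exprn_ge0 ?(ltW th00)//; lra.
  rewrite addnS.
  have := @prob_reach_scale_step h kap k (Num.min 1 (th0 * (1 + kap) ^+ n)) (n0 + n)
    (ltW k0) mh h01 hneg hsub _ IH X iX y.
  rewrite le_min ler01 r0 ge_min lexx => /(_ isT).
  apply: le_trans; rewrite lee_fin ler_wpM2r//; first by case/andP: (h01 y).
  have kap1 : 1 <= 1 + kap by lra.
  rewrite le_min ge_min lexx /= minr_pMl; last by lra.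
  rewrite le_min mul1r; apply/andP; split.
    by apply: le_trans kap1; rewrite ge_min lexx.
  by rewrite exprSr mulrA ge_min lexx orbT.
(* Enough generations for [th0 * (1 + kap) ^+ n >= 1], by Bernoulli's inequality. *)
have [n nth] := exists_mulrn_ge th0^-1 kap0.
exists (n0 + n)%N; last first.
  move=> X iX y yk; have := iter_ub n X iX y.
  rewrite min_l ?mul1r; last first.
    rewrite -ler_pdivrMl// mulr1 (le_trans nth)//.
    by rewrite bernoulli_ge// ltW.
  by apply: le_trans; rewrite lee_fin; exact: hge.
have := hge 1; rewrite ler01 k1 => /(_ isT).
rewrite mulr1 mulrA => /le_trans; apply.
by case/andP: (h01 1).
Qed.

(** This turns the factor [y] into [1 + y]: for [y >= 1] they differ by at most a factor 2, and from
    [y < 1] the walk first climbs above 1 in [m] steps, at the constant cost [p ^+ m]. *)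
Lemma prob_reach_lower : exists2 D : R, 0 < D & forall k, 1 <= k ->
  exists n : nat, forall X, iid X -> forall y, 0 <= y <= k ->
    ((D * (1 + y) * (expR (rho * (y - k)) / k))%:E
       <= P [set w | reach n (X^~ w) k y])%E.
Proof.
have [eps eps0 lowb] := prob_reach_interior.
have rho0 : 0 < rho by exact: lt_le_trans delta_le_rho.
have [eta eta0 peta] := step_up_gt0 beta_gt1 delta_gt0 exp_integrable exp_min exp_critical.
set p := fine (mu `[eta, +oo[%classic).
have p0 : 0 < p by rewrite fine_gt0// peta ltey_eq fin_num_measure.
have p1 : p <= 1 by have /andP[] := @probability_le1_fine `[eta, +oo[%classic (measurable_itv _).
have [m m1] := exists_mulrn_ge 1 eta0.
have pm0 : 0 < p ^+ m by exact: exprn_gt0.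
have pm1 : p ^+ m <= 1 by rewrite exprn_ile1// ltW.
exists (p ^+ m * eps / 2) => [|k k1]; first by rewrite divr_gt0// mulr_gt0.
have k0 : 0 < k by lra.
have [n eps1 lowk] := lowb k k1.
exists (n + m)%N => X iX y /andP[y0 yk].
have ee : 0 < expR (rho * (y - k)) / k by rewrite divr_gt0 ?expR_gt0.
have [y1|y1] := leP 1 y.
  apply: (@le_trans _ _ (P [set w | reach n (X^~ w) k y])); last first.
    apply: le_measure; rewrite ?inE; [exact: reach_measurable|exact: reach_measurable|].
    by move=> w; apply: reach_leq; exact: leq_addr.
  have yk' : 0 <= y <= k by rewrite y0.
  apply: le_trans (lowk X iX y yk'); rewrite lee_fin ler_pM2r//.
  have : 0 <= (1 - p ^+ m) * (eps * (1 + y)) by rewrite !mulr_ge0 ?subr_ge0 ?(ltW eps0)//; lra.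
  have : 0 <= eps * (y - 1) by rewrite mulr_ge0 ?subr_ge0// ltW.
  lra.
pose q := eps * expR (rho * (1 - k)) / k.
have q0 : 0 <= q by rewrite divr_ge0 ?mulr_ge0 ?expR_ge0 ?(ltW eps0)// ltW.
have base X' : iid X' -> forall y', 1 <= y' ->
    (q%:E <= P [set w | reach n (X'^~ w) k y'])%E.
  move=> iX' y' y'1; have [ky'|y'k] := leP k y'.
    by rewrite prob_reach_eq1// (le_trans _ ky')// ltW.
  have y'k' : 0 <= y' <= k by apply/andP; split; lra.
  apply: le_trans (lowk X' iX' y' y'k'); rewrite lee_fin /q -[leLHS]mulrA -[eps in leLHS]mulr1.
  apply: ler_pM.
  - by rewrite mulr1 ltW.
  - by rewrite divr_ge0 ?expR_ge0// ltW.
  - by rewrite ler_pM2l.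
  - by rewrite ler_pM2r ?invr_gt0// ler_expR ler_pM2l//; lra.
have y1m : 1 <= y + m%:R * eta by lra.
apply: le_trans (reach_climb eta0 q0 base iX y0 y1m).
rewrite lee_fin -/p /q.
have -> : p ^+ m * eps / 2 * (1 + y) * (expR (rho * (y - k)) / k) =
   p ^+ m * ((eps * ((1 + y) / 2) * expR (rho * (y - k))) / k) by ring.
rewrite ler_pM2l// ler_pM2r ?invr_gt0// -mulrA ler_pM2l//.
rewrite -[leRHS]mul1r; apply: ler_pM; rewrite ?expR_ge0//; try lra.
by rewrite ler_expR ler_pM2l//; lra.
Qed.

End bounds.

(** * From finitely many generations to the supremum *)

Section killed_max_events.
Context (R : realType) (b : nat) (d : measure_display) (T : measurableType d)
  (P : probability T R) (X : vertex b -> {RV P >-> R}) (x : R).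

Lemma killed_max_eventE k : [set w | (k%:E <= killed_max X x w)%E] =
  \bigcap_(m in [set: nat]) \bigcup_n [set w | reach n (X^~ w) (k - m.+1%:R^-1) x].
Proof.
apply/seteqP; split => w /=.
  by move=> /killed_max_geP H m _; have [n ?] := H m; exists n.
by move=> H; apply/killed_max_geP => m; have [n _ ?] := H m I; exists n.
Qed.

Lemma killed_max_measurable k : measurable [set w | (k%:E <= killed_max X x w)%E].
Proof.
rewrite killed_max_eventE; apply: bigcap_measurable => [|m _]; first by exists 0%N.
by apply: bigcupT_measurable => n; exact: reach_measurable.
Qed.

Lemma prob_killed_max_ge k n :
  (P [set w | reach n (X^~ w) k x] <= P [set w | (k%:E <= killed_max X x w)%E])%E.
Proof.
apply: le_measure; rewrite ?inE; [exact: reach_measurable|exact: killed_max_measurable|].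
move=> w kw /=; apply/killed_max_geP => m; exists n.
by apply: reach_threshold kw; rewrite gerBl invr_ge0.
Qed.

(** A supremum of at least [k] forces level [k - 1] to be reached in some generation; continuity
    from below passes to the union over generations. The unit lost in the level costs only a
    constant factor later. *)
Lemma prob_killed_max_le k (M : \bar R) :
    (forall n, P [set w | reach n (X^~ w) (k - 1) x] <= M)%E ->
  (P [set w | (k%:E <= killed_max X x w)%E] <= M)%E.
Proof.
move=> HM; pose F n := [set w | reach n (X^~ w) (k - 1) x].
have mF n : measurable (F n) by exact: reach_measurable.
have mU : measurable (\bigcup_n F n) by exact: bigcupT_measurable.
apply: (@le_trans _ _ (P (\bigcup_n F n))).
  apply: le_measure; rewrite ?inE//; first exact: killed_max_measurable.
  move=> w /killed_max_geP /(_ 0%N) [n]; rewrite invr1 => ?; by exists n.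
have ndF : nondecreasing_seq F.
  by move=> m n mn; apply/subsetPset => w; exact: reach_leq.
have cv : P \o F @ \oo --> P (\bigcup_n F n) by exact: nondecreasing_cvg_mu.
rewrite -(cvg_lim _ cv)//; apply: lime_le; first by apply/cvg_ex; eexists; exact: cv.
by apply: nearW => n; exact: HM.
Qed.

End killed_max_events.

Theorem corollary4p2 (R : realType) (b : nat) (hb : (2 <= b)%N)
    (d0 : measure_display) (T0 : measurableType d0) (P0 : probability T0 R)
    (X : {RV P0 >-> R})
    (X_nonlattice : ~ lattice_distribution (distribution P0 X))
    (rho : R) (rho_gt0 : 0 < rho)
    (rho_interior : interior [set t : R | ('M_P0 X t < +oo)%E] rho)
    (rho_min : forall t : R, ('M_P0 X rho <= 'M_P0 X t)%E)
    (critical : 'M_P0 X rho = (b%:R^-1)%:E)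
    (d : measure_display) (T : measurableType d) (P : probability T R)
    (Xv : vertex b -> {RV P >-> R})
    (Xv_iid : iid_with_law [set u | u <> tree_root b] Xv (distribution P0 X)) :
  exists D1 D2 : R, [/\ 0 < D1, D1 <= D2 &
    forall x : R, 0 <= x -> exists k0 : R, forall k : R, k0 <= k ->
      ((D1 * (1 + x) * (expR (rho * (x - k)) / k))%:E
         <= P [set w | k%:E <= killed_max Xv x w])%E /\
      (P [set w | k%:E <= killed_max Xv x w]
         <= (D2 * (1 + x) * (expR (rho * (x - k)) / k))%:E)%E].
Proof.
pose mu : probability R R := distribution P0 X.
have ME t : 'M_P0 X t = (\int[mu]_z (expR (t * z))%:E)%E.
  rewrite ge0_integral_distribution.
  - by rewrite /mmt_gen_fun unlock; apply: eq_integral => w _ /=; rewrite mulrC.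
  - apply/measurable_EFinP; exact: measurable_expRM.
  - by move=> z; rewrite lee_fin expR_ge0.
have [e /= e0 ballM] := rho_interior.
(* Then [2 * delta <= e / 2 < e], which keeps [rho + s] inside the ball of finite moments. *)
pose delta := Num.min rho (e / 4).
have delta0 : 0 < delta by rewrite lt_min rho_gt0 divr_gt0.
have delta_rho : delta <= rho by rewrite ge_min lexx.
have fin s : `|s| <= 2 * delta -> ('M_P0 X (rho + s) < +oo)%E.
  move=> sd; apply: ballM; rewrite /ball/= opprD addNKr normrN.
  have : delta <= e / 4 by rewrite ge_min lexx orbT.
  by move: e0; lra.
have Mint s : `|s| <= 2 * delta ->
    mu.-integrable setT (EFin \o (fun z => expR ((rho + s) * z))).
  move=> sd; apply/integrableP; split.
    by apply/measurable_EFinP; exact: measurable_expRM.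
  under eq_integral do rewrite /= ger0_norm ?expR_ge0//.
  by rewrite -ME; exact: fin.
have n0 : `|0 : R| <= 2 * delta by rewrite normr0 mulr_ge0// ltW.
have Mint0 := Mint 0 n0; rewrite addr0 in Mint0.
have Mmin s : `|s| <= 2 * delta ->
    \int[mu]_z (expR (rho * z)) <= \int[mu]_z (expR ((rho + s) * z)).
  move=> sd; apply: fine_le; [exact: integrable_fin_num|exact: (integrable_fin_num _ (Mint s sd))|].
  by have := rho_min (rho + s); rewrite !ME.
have Mcrit : \int[mu]_z (expR (rho * z)) = b%:R^-1.
  by rewrite /Rintegral -ME critical.
have [A A1 upper] := prob_reach_upper P hb delta0 delta_rho Mint Mmin Mcrit.
have [D D0 lower] := prob_reach_lower P hb delta0 delta_rho Mint Mmin Mcrit.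
(* The upper bound is used at level [k - 1]: the shift in the exponent gives [expR rho], and
   [1 / (k - 1) <= 2 / k] gives the 2. The maximum secures [D1 <= D2]. *)
exists D, (Num.max D (2 * A * expR rho)); split => //; first by rewrite le_max lexx.
(* This threshold yields [x <= k] for the lower bound and [2 <= k] for the comparison of
   [1 / (k - 1)] with [2 / k]. *)
move=> x x0; exists (x + 2) => k xk.
have k1 : 1 <= k by lra.
have k0 : 0 < k by lra.
split.
  have [n lown] := lower k k1.
  apply: le_trans (prob_killed_max_ge Xv x k n); apply: lown => //.
  by rewrite x0; lra.
apply: prob_killed_max_le => n; have km1 : 0 < k - 1 by lra.
apply: le_trans (upper Xv n (k - 1) x Xv_iid km1 x0) _; rewrite lee_fin.
have E0 : 0 < expR (rho * (x - k)) by exact: expR_gt0.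
have -> : rho * (x - (k - 1)) = rho * (x - k) + rho by ring.
rewrite expRD; set E := expR (rho * (x - k)).
have kk : (k - 1)^-1 <= 2 * k^-1.
  by rewrite -[2 * _]invrK invfM invrK lef_pV2 ?posrE//; lra.
apply: (@le_trans _ _ (2 * A * expR rho * (1 + x) * (E / k))).
  have -> : A * (1 + x) * (E * expR rho / (k - 1)) =
     A * (1 + x) * E * expR rho * (k - 1)^-1 by ring.
  have -> : 2 * A * expR rho * (1 + x) * (E / k) =
     A * (1 + x) * E * expR rho * (2 * k^-1) by ring.
  rewrite ler_wpM2l// !mulr_ge0 ?expR_ge0//; lra.
rewrite ler_wpM2r ?divr_ge0 ?expR_ge0 ?(ltW k0)// ler_wpM2r ?le_max ?lexx ?orbT//; lra.
Qed.
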